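(* Let $U_T$, $U$, $\mathbb Z_T$, $\mathbb V_T$, $\mathbb Z$, $\mathcal G$, $\hat\theta_T$, $\hat u_T=a_T^{-1}(\hat\theta_T-\theta^* )$ be as described in the context. Consider the conditions: [A1] $\displaystyle \varlimsup_{R\to\infty}\varlimsup_{T\to\infty}P\Big[\sup_{(u,\tau)\in U_T\times\mathcal T,\ |u|\ge R}\mathbb Z_T(u,\tau)\ge 1\Big]=0$. [A2] For every $R>0$, as $T\to\infty$, $\displaystyle\sup_{(u,\tau)\in U_T(R)\times\mathcal T}|\mathbb Z_T(u,\tau)-\mathbb V_T(u)|\to 0$ in probability, and the restriction of $\mathbb V_T$ to $\overline{B_R}$ converges $\mathcal G$-stably to the restriction of $\mathbb Z$ to $\overline{B_R}$ in $C(\overline{B_R})$. [A3] $\displaystyle U\supset\bigcap_{N=1}^\infty\overline{\bigcup_{T\ge N}U_T}$. [A4] There exists a $U$-valued random variable $\hat u$ such that with probability $1$, $\mathbb Z(\hat u)=\sup_{u\in U}\mathbb Z(u)$, and with probability $1$, $\mathbb Z(u)<\mathbb Z(\hat u)$ for all $u\in U$ with $u\ne\hat u$. [A5] There exist $T_0\in\mathbb T$ and $U$-valued random variables $\hat v_T$ ($T\in\mathbb T$, $T\ge T_0$) such that with probability $1$, $\mathbb V_T(\hat v_T)=\sup_{u\in U}\mathbb V_T(u)$, and such that $\{\hat v_T\}_{T\ge T_0,T\in\mathbb T}$ is tight. Under [A1]--[A4], $$\hat u_T\xrightarrow{d_s(\mathcal G)}\hat u\qquad(T\to\infty).$$ Moreover,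 if [A5] also holds, then $$\hat u_T-\hat v_T=o_P(1).$$
   Context: $(\Omega,\mathcal F,P)$ is a probability space, $\mathcal G\subset\mathcal F$ a sub-$\sigma$-algebra. $\Theta\subset\mathbb R^{\mathsf p}$ and $\mathcal T\subset\mathbb R^{\mathsf q}$ are measurable sets, $\Xi=\Theta\times\mathcal T$. The index set $\mathbb T\subset\mathbb R$ satisfies $\sup\mathbb T=\infty$; limits $T\to\infty$, and unions/intersections over $T\ge N$, are over $T\in\mathbb T$. For each $T\in\mathbb T$, $\mathbb H_T:\Omega\times\Xi\to\mathbb R$ is a continuous random field (for each $\omega$, $\mathbb H_T(\omega)$ is continuous on $\Xi$). $\theta^*\in\Theta$ is a fixed point (the true value). For each $T$, $\hat\tau_T$ is an arbitrary $\mathcal T$-valued random variable and $\hat\theta_T$ is a $\Theta$-valued random variable that asymptotically maximizes $\mathbb H_T(\cdot,\hat\tau_T)$ on $\Theta$, i.e. $P[\mathbb H_T(\hat\theta_T,\hat\tau_T)=\sup_{\theta\in\Theta}\mathbb H_T(\theta,\hat\tau_T)]\to1$. $a_T\in GL(\mathsf p)$ ($T\in\mathbb T$) are deterministic matrices with $\|a_T\|\to0$, where $\|A\|=\{\mathrm{Tr}(AA')\}^{1/2}$ and $A'$ is the transpose. Define $U_T=\{u\in\mathbb R^{\mathsf p};\ \theta^*+a_Tu\in\Theta\}$ and $$\mathbb Z_T(u,\tau)=\exp\big(\mathbb H_T(\theta^*+a_Tu,\tau)-\mathbb H_T(\theta^*,\tau)\big)\qquad(u\in U_T,\ \tau\in\mathcal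 T).$$ For $A\subset\mathbb R^{\mathsf p}$, $\delta>0$, $R>0$: $A^\delta=\{x\in\mathbb R^{\mathsf p};\ \inf_{a\in A}|x-a|<\delta\}$, $B_R=\{x\in\mathbb R^{\mathsf p};|x|<R\}$, $A(R)=A\cap\overline{B_R}$. Define $$U=\bigcap_{\delta>0}\bigcup_{N=1}^\infty\bigcap_{T\ge N}U_T^{\,\delta}.$$ $C(\mathbb R^{\mathsf p})$ is the space of continuous functions on $\mathbb R^{\mathsf p}$ with the topology of uniform convergence on compacts (metric $d_\infty(f,g)=\sum_{n\ge1}2^{-n}(1\wedge\max_{|x|\le n}|f(x)-g(x)|)$). $\mathbb V_T$ ($T\in\mathbb T$) and $\mathbb Z$ are $C(\mathbb R^{\mathsf p})$-valued random variables. For random variables $Y_T,Y$ in a topological space $S$, $Y_T\xrightarrow{d_s(\mathcal G)}Y$ ($\mathcal G$-stable convergence) means $E[f(Y_T)Z]\to E[f(Y)Z]$ as $T\to\infty$ for every bounded continuous $f$ on $S$ and every bounded $\mathcal G$-measurable random variable $Z$. *)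

(* Defs.v *)
From HB Require Import structures.
From mathcomp Require Import all_boot all_order all_algebra.
From mathcomp Require Import all_classical all_reals all_analysis.

Set Implicit Arguments.
Unset Strict Implicit.
Unset Printing Implicit Defensive.

Import Order.TTheory GRing.Theory Num.Theory.
Import numFieldNormedType.Exports.

Local Open Scope classical_set_scope.
Local Open Scope ring_scope.

(* The norm `|_| that the library puts on matrices is the max norm (it induces
   the same topology); the Euclidean and Frobenius norms are defined here. *)
Definition enorm (R : realType) (n : nat) (x : 'cV[R]_n) : R :=
  Num.sqrt (\sum_(i < n) x i ord0 ^+ 2).

Definition frobnorm (R : realType) (m n : nat) (A : 'M[R]_(m, n)) : R :=
  Num.sqrt (\tr (A *m A^T)).

Definition eball (R : realType) (n : nat) (r : R) : set 'cV[R]_n :=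
  [set x | enorm x < r].

(* A^delta; the infimum is taken in the extended reals, so it is empty when A
   is. *)
Definition thicken (R : realType) (n : nat) (A : set 'cV[R]_n) (delta : R) :
    set 'cV[R]_n :=
  [set x | (ereal_inf [set (enorm (x - y))%:E | y in A] < delta%:E)%E].

(* T -> oo along the index set TT. *)
Definition at_infty (R : realType) (TT : set R) : set_system R :=
  within TT (pinfty_nbhs R).

Definition tail (R : realType) (TT : set R) (r : R) : set R :=
  [set t | TT t /\ r <= t].

Definition borel (S : topologicalType) : set (set S) := <<s [set O | open O] >>.
Arguments borel : clear implicits.

Definition random_element d (Omega : measurableType d) (S : topologicalType)
    (X : Omega -> S) : Prop :=
  forall B, borel S B -> measurable (X @^-1` B).

Definition measurable_wrt d (Omega : measurableType d) (R : realType)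
    (G : set (set Omega)) (Z : Omega -> R) : Prop :=
  forall B : set R, measurable B -> G (Z @^-1` B).

Definition stable_cvg d (Omega : measurableType d) (R : realType)
    (P : probability Omega R) (G : set (set Omega)) (I : Type)
    (F : set_system I) (S : topologicalType)
    (Y_ : I -> Omega -> S) (Y : Omega -> S) : Prop :=
  forall (f : S -> R) (Z : Omega -> R),
    continuous f -> bounded_fun f ->
    measurable_wrt G Z -> bounded_fun Z ->
    ('E_P[fun w => (f (Y_ i w) * Z w)%R])%E @[i --> F] -->
    ('E_P[fun w => (f (Y w) * Z w)%R])%E.

(* X_i -> 0 in probability; values in \bar R accommodate suprema that may be
   infinite. *)
Definition cvg0_in_probability d (Omega : measurableType d) (R : realType)
    (P : probability Omega R) (I : Type) (F : set_system I)
    (X_ : I -> Omega -> \bar R) : Prop :=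
  forall eps : R, 0 < eps ->
    P [set w | (eps%:E < `|X_ i w|)%E] @[i --> F] --> 0%E.

Definition tight_on d (Omega : measurableType d) (R : realType)
    (P : probability Omega R) (I : Type) (J : set I) (S : topologicalType)
    (X_ : I -> Omega -> S) : Prop :=
  forall eps : R, 0 < eps -> exists2 K : set S, compact K &
    forall i, J i -> (P (X_ i @^-1` (~` K)) <= eps%:E)%E.

(* C(X) with the topology of uniform convergence on compact sets. When X is
   itself compact this is the topology of uniform convergence on X. *)
Definition Cspace (X : topologicalType) (R : realType) : Type :=
  continuousType X R.

HB.instance Definition _ (X : topologicalType) (R : realType) :=
  Topological.copy (Cspace X R)
    (initial_topology
       (fun f : continuousType X R => (f : X -> R) : {family compact, X -> R})).

Definition Ceval (X : topologicalType) (R : realType) (f : Cspace X R) : X -> R :=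
  @Continuous.sort X R f.
Coercion Ceval : Cspace >-> Funclass.

Lemma restrict_continuous (X : topologicalType) (R : realType) (K : set X)
  (f : Cspace X R) : continuous (fun x : set_type K => f (set_val x)).
Proof.
move=> x; apply: (@continuous_comp (set_type K) X R set_val f).
  exact: initial_continuous.
exact: (@cts_fun X R f).
Qed.

Definition Crestrict (X : topologicalType) (R : realType) (K : set X)
    (f : Cspace X R) : Cspace (set_type K) R :=
  [the continuousType (set_type K) R of mkcts (@restrict_continuous X R K f)].

(* U_T, with a = a_T *)
Definition local_set (R : realType) (p : nat) (Theta : set 'cV[R]_p)
    (theta : 'cV[R]_p) (a : 'M[R]_p) : set 'cV[R]_p :=
  [set u | Theta (theta + a *m u)].

(* U, from the family T |-> U_T *)
Definition limit_set (R : realType) (p : nat) (TT : set R)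
    (U_ : R -> set 'cV[R]_p) : set 'cV[R]_p :=
  \bigcap_(delta in [set delta : R | 0 < delta])
    \bigcup_(N in [set N : nat | (0 < N)%N])
      \bigcap_(t in tail TT N%:R) thicken (U_ t) delta.

(* ZZ_T(u, tau), with h = HH_T(omega) and a = a_T *)
Definition likelihood_ratio (R : realType) (p q : nat) (theta : 'cV[R]_p)
    (a : 'M[R]_p) (h : 'cV[R]_p * 'cV[R]_q -> R)
    (u : 'cV[R]_p) (tau : 'cV[R]_q) : R :=
  expR (h (theta + a *m u, tau) - h (theta, tau)).

(* Main.v *)
Require Import Defs.
From HB Require Import structures.
From mathcomp Require Import all_boot all_order all_algebra.
From mathcomp Require Import all_classical all_reals all_analysis.
From mathcomp Require Import measurable_realfun lra ring.

Set Implicit Arguments.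
Unset Strict Implicit.
Unset Printing Implicit Defensive.

Import Order.TTheory GRing.Theory Num.Theory.
Import numFieldNormedType.Exports.

Local Open Scope classical_set_scope.
Local Open Scope ring_scope.

(** This is an argmax theorem in which the maximizers are only approximate and
    the sets over which they maximize move with t.

    A point v is called a near-maximizer of f at scale e, inside an open window
    D, when v lies in D within e of U, and when every u in U whose e-ball stays
    in D has a point x in that ball with f x <= f v + e.  Asking for some x near
    u, rather than for u itself, absorbs at once the two approximations of the
    theorem: ZZ_t is only uniformly close to V_t, and the points of U are only
    limits of points of the sets U_t.  Near-maximality survives uniform
    perturbations of f (near_argmax_perturb), and when e tends to 0 the cluster
    points of near-maximizers of a continuous f maximize f over the part of U in
    the window (near_argmax_cluster).  If f has a unique maximizer on U, and it
    lies in the window, then the cluster points are equal to it.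

    Condition A1 confines the rescaled estimator to a ball outside an event of
    small probability; A2, A3 and the definition of U then make it a
    near-maximizer of V_t at any prescribed scale (maximizer_near_argmax).  The
    exact maximizers of A5 are near-maximizers too, tightness supplying the
    ball.  So both assertions follow from a statement on two families X_t, Y_t
    of near-maximizers of V_t (limsup_mean_argmax_pair): for phi continuous and
    zeta G-measurable, both with values in [0, 1],
      limsup E[phi(X_t, Y_t) zeta] <= E[phi(uhat, uhat) zeta].
    To prove it, phi(X_t, Y_t) is bounded by g(V_t), where g is a continuous
    functional on C(closed ball): the supremum over all s, v, v', with v and v'
    near-maximizers of s, of phi(v, v') times a tent of radius e around s in the
    uniform distance (bump_functional, argmax_test).  Stable convergence
    replaces V_t by Z, and when e tends to 0 uniqueness of the maximizer brings
    g(Z) down to phi(uhat, uhat); dominated convergence concludes.  Taking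
    phi(x, y) = psi x and 1 - psi x gives the stable convergence of the
    estimator; taking for phi the truncated distance between x and y, which
    vanishes on the diagonal, gives the asymptotic equivalence of the two
    families.

    Conditions A1 and A2 bound the probabilities of events defined by suprema
    over uncountable sets.  These bounds can be combined only once the events
    are known to be measurable.  This holds because the fields are continuous on
    subsets of a separable space, so that a supremum may be taken over a
    countable dense set, and because the value of a continuous random field at
    a random point is measurable (measurable_random_field_comp). *)

(** * Continuous functionals on spaces of continuous functions *)

Lemma sup_image_le1 (R : realType) (I : Type) (A : set I) (a : I -> R) :
  (forall i, 0 <= a i <= 1) -> 0 <= sup (a @` A) <= 1.
Proof.
move=> a01; have [->|/set0P[i Ai]] := eqVneq A set0.
  by rewrite image_set0 sup0 lexx ler01.
have ub1 : ubound (a @` A) 1 by move=> _ [j _ <-]; have /andP[] := a01 j.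
have ne : a @` A !=set0 by exists (a i), i.
rewrite ge_sup // andbT; have /andP[h _] := a01 i; apply: (le_trans h).
by apply: ub_le_sup; [exists 1|exists i].
Qed.

Lemma sup_image_dist (R : realType) (I : Type) (A : set I) (a b : I -> R)
    (e : R) :
  (forall i, 0 <= a i <= 1) -> (forall i, 0 <= b i <= 1) -> 0 <= e ->
  (forall i, A i -> `|a i - b i| <= e) ->
  `|sup (a @` A) - sup (b @` A)| <= e.
Proof.
move=> a01 b01 e0 ab; have [->|/set0P[i Ai]] := eqVneq A set0.
  by rewrite !image_set0 subrr normr0.
have aux (c d : I -> R) : (forall i, 0 <= d i <= 1) ->
    (forall i, A i -> c i - d i <= e) -> sup (c @` A) <= sup (d @` A) + e.
  move=> d01 cd; apply: ge_sup; first by exists (c i), i.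
  move=> _ [j Aj <-]; rewrite -lerBlDr; apply: (@le_trans _ _ (d j)).
    by rewrite lerBlDr -lerBlDl cd.
  apply: ub_le_sup; last by exists j.
  by exists 1 => _ [k _ <-]; have /andP[] := d01 k.
rewrite ler_distlC; apply/andP; split.
  rewrite lerBlDr; apply: aux => // j Aj.
  by rewrite (le_trans _ (ab j Aj)) // ler_norm.
apply: aux => // j Aj.
by rewrite (le_trans _ (ab j Aj)) // distrC ler_norm.
Qed.

Lemma Ceval_initial_continuous (X : topologicalType) (R : realType) :
  continuous ((fun f : Cspace X R => (f : X -> R))
    : Cspace X R -> {family compact, X -> R}).
Proof.
exact: (@initial_continuous (continuousType X R) {family compact, X -> R}
  (fun f => f)).
Qed.

Lemma near_Cspace (X : topologicalType) (R : realType) (K : set X)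
    (f : Cspace X R) (e : R) : compact K -> 0 < e ->
  nbhs f [set h : Cspace X R | forall x, K x -> `|f x - h x| < e].
Proof.
move=> cK e0.
have E : entourage [set xy : R * R | ball xy.1 e xy.2].
  exact: entourage_ball (PosNum e0).
have H := fam_nbhs (f : {family compact, X -> R}) E cK.
exact: (@Ceval_initial_continuous X R f _ H).
Qed.

(** Uniform continuity for the uniform distance on K.  Unlike continuity, it
    passes from the functions on the subtype K to the functions on the whole
    space without any comparison of the two topologies. *)
Definition unif_continuous_on (X : topologicalType) (R : realType) (K : set X)
    (g : Cspace X R -> R) :=
  forall e : R, 0 < e -> exists2 r, 0 < r &
    forall f h : Cspace X R, (forall x, K x -> `|f x - h x| < r) ->
      `|g f - g h| <= e.

Lemma unif_continuous_onW (X : topologicalType) (R : realType) (K : set X)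
    (g : Cspace X R -> R) :
  compact K -> unif_continuous_on K g -> continuous g.
Proof.
move=> cK gK f; have FF : Filter (nbhs f) := nbhs_filter (f : Cspace X R).
apply/(@cvgrPdist_le _ _ _ (nbhs f) FF) => e e0; have [r r0 gr] := gK _ e0.
by apply: (@filterS _ _ FF _ _ _ (near_Cspace f cK r0)) => h; exact: gr.
Qed.

(** A cluster point in X of the image filter belongs to K, and the topology of
    the subtype is the one induced by X. *)
Lemma compact_set_type (X : topologicalType) (K : set X) :
  compact K -> compact [set: set_type K].
Proof.
move=> cK F FF _.
have [|x [Kx clx]] := cK (set_val @ F) (fmap_proper_filter _ FF).
  by apply: (@filterS _ F _ setT) => [x _|]; [exact: set_valP|exact: filterT].
exists (SigSub (mem_set Kx)); split => // A B FA nB.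
have [B' [[C oC CB] B'x sB]] := nB.
have : nbhs x C.
  by apply: open_nbhs_nbhs; split => //; move: B'x; rewrite -CB.
move=> /(clx (set_val @` A)) [].
  have sA : A `<=` set_val @^-1` (set_val @` A) by move=> a Aa; exists a.
  exact: (filterS sA FA).
move=> _ [[a Aa <-] Ca]; exists a; split => //.
by apply: sB; rewrite -CB.
Qed.

Lemma unif_continuous_on_restrict (X : topologicalType) (R : realType)
    (K : set X) (g : Cspace (set_type K) R -> R) :
  unif_continuous_on setT g -> unif_continuous_on K (g \o Crestrict K).
Proof.
move=> ug e /ug[r r0 gr]; exists r => // f h fh; apply: gr => x _.
by apply: fh; exact: set_valP.
Qed.

Lemma Ceval_continuous (X : topologicalType) (R : realType) (x : X) :
  continuous (fun f : Cspace X R => f x).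
Proof.
apply: (unif_continuous_onW (@compact_set1 X x)) => e e0; exists e => // f h.
by move=> fh; apply/ltW/fh.
Qed.

(** The tent functional g f = sup_i c_i (1 - d(f, s_i)), where d is the uniform
    distance in units of r, truncated at 1.  It replaces the indicator of the
    set of the s_i by a uniformly continuous function, weighted by the c_i. *)
Lemma bump_functional (X : topologicalType) (R : realType) (I : Type)
    (A : set I) (s : I -> X -> R) (c : I -> R) (r : R) :
  0 < r -> (forall i, 0 <= c i <= 1) ->
  exists g : Cspace X R -> R,
    [/\ unif_continuous_on setT g, (forall f, 0 <= g f <= 1),
        (forall i (f : Cspace X R), A i ->
           (forall x, f x = s i x) -> c i <= g f) &
        (forall (f : Cspace X R) (m : R), 0 <= m -> m < g f ->
           exists i, [/\ A i, m < c i & forall x, `|f x - s i x| < r])].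
Proof.
move=> r0 c01.
pose t (f : X -> R) i x := Num.min 1 (`|f x - s i x| / r).
pose dst (f : X -> R) i := sup (t f i @` setT).
pose a f i := c i * (1 - dst f i).
have t01 f i x : 0 <= t f i x <= 1.
  by rewrite /t ge_min lexx le_min ler01 /= andbT divr_ge0 // ltW.
have dst01 f i : 0 <= dst f i <= 1 by apply: sup_image_le1 => x.
have a01 f i : 0 <= a f i <= 1.
  have /andP[c0 c1] := c01 i; have /andP[d0 d1] := dst01 f i.
  by rewrite /a; nra.
exists (fun f => sup (a f @` A)); split.
- move=> e e0; exists (e * r); first exact: mulr_gt0.
  move=> f h fh; apply: sup_image_dist => //; first exact: ltW.
  move=> i Ai; rewrite /a -mulrBr normrM.
  have /andP[c0 c1] := c01 i.
  rewrite ger0_norm // -[leRHS]mul1r ler_pM //.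
  rewrite [X in `|X|](_ : _ = dst h i - dst f i); last by lra.
  apply: sup_image_dist => //; first exact: ltW.
  move=> x _; rewrite /t.
  have hf : `| `|h x - s i x| / r - `|f x - s i x| / r | <= e.
    rewrite -mulrBl normrM (ger0_norm (_ : 0 <= r^-1)); last first.
      by rewrite invr_ge0 ltW.
    rewrite ler_pdivrMr // (le_trans (ler_dist_dist _ _)) //.
    rewrite [X in `|X|](_ : _ = h x - f x); last by lra.
    by rewrite distrC ltW // fh.
  have e0' := ltW e0.
  move: hf; rewrite !ler_distlC !minEle.
  by do 2 case: ifP; move=> /=; lra.
- by move=> f; apply: sup_image_le1 => i.
- move=> i f Ai fs; apply: (@le_trans _ _ (a f i)).
    rewrite /a (_ : dst f i = 0) ?subr0 ?mulr1 //.
    rewrite /dst (_ : t f i = fun=> 0); last first.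
      by apply/funext => x; rewrite /t fs subrr normr0 mul0r minEle ler10.
    have [E|/set0P[x _]] := eqVneq [set: X] set0.
      by rewrite E image_set0 sup0.
    rewrite (_ : _ @` _ = [set 0]) ?sup1 //.
    by apply/seteqP; split => [_ [_ _ <-]|_ ->] //; exists x.
  apply: ub_le_sup; last by exists i.
  by exists 1 => _ [j _ <-]; have /andP[] := a01 f j.
- move=> f m m0 mg.
  have [E|An0] := eqVneq A set0.
    by move: mg; rewrite E image_set0 sup0 ltNge m0.
  have [|_ [i Ai <-] mi] := sup_gt _ mg.
    by case/set0P: An0 => i Ai; exists (a f i), i.
  have /andP[c0 c1] := c01 i; have /andP[d0 d1] := dst01 f i.
  exists i; split => //; first by move: mi; rewrite /a; nra.
  move=> x.
  have tx : t f i x <= dst f i.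
    apply: ub_le_sup; last by exists x.
    by exists 1 => _ [y _ <-]; have /andP[] := t01 f i y.
  have dlt : dst f i < 1 by move: mi; rewrite /a; nra.
  move: (le_lt_trans tx dlt); rewrite /t gt_min ltxx /=.
  by rewrite ltr_pdivrMr // mul1r.
Qed.

(** * Measurability of continuous random fields on separable spaces *)

Lemma measurable_ext d (T : measurableType d) (A B : set T) :
  (forall x, A x <-> B x) -> measurable A -> measurable B.
Proof. by move=> AB; rewrite (_ : A = B) //; apply/predeqP. Qed.

Lemma random_element_fun d (Omega : measurableType d) (S : topologicalType)
    (R : realType) (X : Omega -> S) (f : S -> R) :
  random_element X -> continuous f -> measurable_fun setT (f \o X).
Proof.
move=> mX cf.
apply: (measurability _ (RGenOInfty.measurableE R)).
move=> _ [_ [c ->] <-]; rewrite setTI; apply: (mX (f @^-1` `]c, +oo[)).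
apply: sub_sigma_algebra => /=; move/continuousP: cf; apply.
exact: interval_open.
Qed.

Lemma random_element_comp d (Omega : measurableType d) (S S' : topologicalType)
    (X : Omega -> S) (f : S -> S') :
  random_element X -> continuous f -> random_element (f \o X).
Proof.
move=> mX cf B; rewrite /borel.
pose M := [set B : set S' | measurable ((f \o X) @^-1` B)].
suff : <<s [set O | open O] >> `<=` M by apply.
apply: smallest_sub.
  split; rewrite /M /=.
  - exact: measurable0.
  - by move=> A mA; rewrite setTD preimage_setC; exact: measurableC.
  - by move=> F mF; rewrite preimage_bigcup; exact: bigcupT_measurable.
move=> O oO; apply: (mX (f @^-1` O)); apply: sub_sigma_algebra => /=.
by move/continuousP: cf; apply.
Qed.

Lemma random_element_ball d (Omega : measurableType d) (R : realType)
    (V : normedModType R) (X : Omega -> V) (x : V) (e : R) :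
  random_element X -> measurable [set w | ball x e (X w)].
Proof.
move=> mX; apply: (mX (ball x e)); apply: sub_sigma_algebra.
exact: ball_open.
Qed.

Lemma exists_invS_lt (R : realType) (e : R) :
  0 < e -> exists n : nat, (n.+1%:R^-1 : R) < e.
Proof.
move=> e0; exists (Num.truncn e^-1).
by rewrite invf_plt ?posrE ?ltr0n //; exact: truncnS_gt.
Qed.

Definition separable (R : realType) (T : pseudoMetricType R) :=
  exists q : nat -> T,
    forall (x : T) (e : R), 0 < e -> exists i, ball (q i) e x.

Lemma separable_cV (R : realType) n : @separable R 'cV[R]_n.
Proof.
pose q k : 'cV[R]_n := map_mx ratr (odflt 0 (unpickle k : option 'cV[rat]_n)).
exists q => x e e0.
have ex i : exists r : rat, ball (ratr r : R) e (x i ord0).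
  have /rat_in_itvoo[r] : x i ord0 - e < x i ord0 + e by lra.
  by rewrite in_itv /= => h; exists r; rewrite /ball /= ltr_distlC; lra.
pose y : 'cV[rat]_n := \matrix_(i, j) projT1 (cid (ex i)).
exists (pickle y); split => // i j; rewrite /q pickleK /= !mxE (ord1 j).
exact: projT2 (cid (ex i)).
Qed.

Lemma separable_prod (R : realType) (T T' : pseudoMetricType R) :
  separable T -> separable T' -> @separable R (T * T')%type.
Proof.
move=> [q qT] [q' qT'].
pose c k := odflt (0%N, 0%N) (unpickle k : option (nat * nat)).
exists (fun k => (q (c k).1, q' (c k).2)) => x e e0.
have [i qi] := qT x.1 e e0; have [j qj] := qT' x.2 e e0.
by exists (pickle (i, j)); rewrite /c pickleK.
Qed.

(** Separability is inherited by every subset X: choose a point of X in each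
    ball of radius 1/(k+1) around a point of the dense sequence that meets X. *)
Lemma dense_sequence (R : realType) (T : pseudoMetricType R) (X : set T) :
  separable T -> X !=set0 ->
  exists s : nat -> T, (forall n, X (s n)) /\
    forall x e, X x -> 0 < e -> exists n, ball (s n) e x.
Proof.
move=> [q qT] [x0 Xx0].
pose c k := odflt (0%N, 0%N) (unpickle k : option (nat * nat)).
pose B k := X `&` ball (q (c k).1) (c k).2.+1%:R^-1.
have ex k : exists y, X y /\ (B k !=set0 -> B k y).
  have [[y [Xy Bky]]|nB] := pselect (B k !=set0); first by exists y.
  by exists x0.
exists (fun k => projT1 (cid (ex k))); split=> [k|x e Xx e0].
  by have [] := projT2 (cid (ex k)).
have e20 : 0 < e / 2 by rewrite divr_gt0.
have [n ne] := exists_invS_lt e20.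
have n0 : 0 < n.+1%:R^-1 :> R by rewrite invr_gt0 ltr0n.
have [i qi] := qT x _ n0.
pose k := pickle (i, n); exists k.
have [Xy] := projT2 (cid (ex k)); set y := projT1 _ in Xy *.
have Bx : B k x by split; rewrite // /c pickleK.
case; first by exists x.
rewrite /c pickleK /= => _ qy.
apply: (@ball_split R T (q i)).
  by apply: ball_sym; apply: le_ball qy; exact: ltW.
by apply: le_ball qi; exact: ltW.
Qed.

Section random_field.
Context d (Omega : measurableType d) (R : realType) (T : pseudoMetricType R).
Variables (X : set T) (f : Omega -> T -> R).
Hypothesis sepT : separable T.
Hypothesis mf : forall x, X x -> measurable_fun [set: Omega] (f ^~ x).
Hypothesis cf : forall w, {within X, continuous (f w)}.

Let cfP w x : X x -> forall e : R, 0 < e -> exists2 r : R, 0 < r &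
  forall y, X y -> ball x r y -> `|f w x - f w y| < e.
Proof.
move=> Xx e e0.
have /(@subspace_continuousP _ X _ (f w))/(_ x Xx) := @cf w.
move=> /cvgrPdist_lt/(_ e e0); rewrite near_withinE => /nbhs_ballP[r /= r0 h].
by exists r => // y Xy xy; apply: h.
Qed.

(** By continuity a value above c is also reached along a dense sequence of X,
    so the event is a countable union. *)
Lemma measurable_exists_gt (c : R) :
  measurable [set w | exists2 x, X x & c < f w x].
Proof.
have [->|/set0P X0] := eqVneq X set0.
  by rewrite (_ : mkset _ = set0) // -subset0 => w [].
have [s [Xs sX]] := dense_sequence sepT X0.
rewrite (_ : mkset _ = \bigcup_n [set w | c < f w (s n)]); last first.
  apply/seteqP; split => w /=; last by move=> [n _ h]; exists (s n).
  move=> [x Xx cx]; have e0 : 0 < f w x - c by lra.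
  have [r r0 h] := cfP w Xx e0; have [n sn] := sX x r Xx r0.
  exists n => //=; have := h (s n) (Xs n) (ball_sym sn).
  by move=> /(le_lt_trans (ler_norm _)); lra.
apply: bigcupT_measurable => n; have := mf (Xs n) measurableT.
move=> /(_ `]c, +oo[%classic (measurable_itv _)); rewrite setTI.
by apply: measurable_ext => w; rewrite /= in_itv /= andbT.
Qed.

Lemma measurable_sup :
  measurable_fun setT (fun w => ereal_sup [set (f w x)%:E | x in X]).
Proof.
apply: (measurability _ (ErealGenOInfty.measurableE R)).
move=> _ [_ [c ->] <-]; rewrite setTI.
have := measurable_exists_gt c; apply: measurable_ext => w /=.
rewrite in_itv /= andbT; split.
  move=> [x Xx cx]; rewrite (@lt_le_trans _ _ (f w x)%:E) ?lte_fin //.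
  by apply: ereal_sup_ubound; exists x.
by move=> /ereal_sup_gt[_ [x Xx <-]]; rewrite lte_fin; exists x.
Qed.

(** The value at Y w is the limit of the values at the points of a dense
    sequence close to Y w.  Writing this with countable quantifiers, uniformly
    over all the points of the sequence in the ball of radius 1/(n+1), avoids a
    measurable selection of the approximating point. *)
Lemma measurable_random_field_comp (Y : Omega -> T) :
  (forall w, X (Y w)) ->
  (forall x e, measurable [set w | ball x e (Y w)]) ->
  measurable_fun setT (fun w => f w (Y w)).
Proof.
move=> XY mY.
have [X0|nX0] := pselect (X !=set0); last first.
  have E : [set: Omega] = set0.
    by apply/eqP/negP => /negP/set0P[w _]; apply: nX0; exists (Y w).
  by rewrite E; exact: measurable_fun_set0.
have [s [Xs sX]] := dense_sequence sepT X0.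
apply: (measurability _ (RGenOInfty.measurableE R)).
move=> _ [_ [c ->] <-]; rewrite setTI.
rewrite (_ : _ @^-1` _ = \bigcup_k \bigcup_m \bigcap_(n in [set n | (m <= n)%N])
    \bigcap_i (~` [set w | ball (s i) n.+1%:R^-1 (Y w)] `|`
               [set w | c + k.+1%:R^-1 <= f w (s i)])); last first.
  apply/seteqP; split => w; rewrite /= in_itv /= andbT.
    move=> cY; have e0 : 0 < (f w (Y w) - c) / 2.
      by rewrite divr_gt0 // subr_gt0.
    have [r r0 h] := cfP w (XY w) e0.
    have [k ke] := exists_invS_lt e0.
    exists k => //; exists (Num.truncn (r^-1)) => // n /= mn i _.
    have nr : n.+1%:R^-1 <= r.
      rewrite invf_ple ?posrE ?ltr0n // ltW //.
      by rewrite (lt_le_trans (truncnS_gt _)) // ler_nat ltnS.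
    have [b|] := pselect (ball (s i) n.+1%:R^-1 (Y w)); last by left.
    right => /=; have := h (s i) (Xs i) (ball_sym (le_ball nr b)).
    move=> /(le_lt_trans (ler_norm _)) hs.
    by rewrite -lerBrDl; apply: ltW; apply: (lt_trans ke); lra.
  move=> [k _ [m _ h]].
  have k0 : 0 < k.+1%:R^-1 :> R by rewrite invr_gt0 ltr0n.
  have [r r0 hr] := cfP w (XY w) k0.
  pose n := maxn m (Num.truncn (r^-1)).
  have nr : n.+1%:R^-1 <= r.
    rewrite invf_ple ?posrE ?ltr0n // ltW //.
    by rewrite (lt_le_trans (truncnS_gt _)) // ler_nat ltnS leq_maxr.
  have n0 : 0 < n.+1%:R^-1 :> R by rewrite invr_gt0 ltr0n.
  have [i si] := sX (Y w) _ (XY w) n0.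
  have [//|/=] := h n (leq_maxl _ _) i I.
  have := hr (s i) (Xs i) (ball_sym (le_ball nr si)).
  rewrite ltr_distlC => /andP[_]; move: (k.+1%:R^-1) => u; lra.
apply: bigcupT_measurable => k; apply: bigcupT_measurable => m.
apply: bigcap_measurable => [|n _]; first by exists m => /=.
apply: bigcapT_measurable => i; apply: measurableU.
  exact/measurableC/mY.
have := mf (Xs i) measurableT.
move=> /(_ `[c + k.+1%:R^-1, +oo[%classic (measurable_itv _)); rewrite setTI.
by apply: measurable_ext => w; rewrite /= in_itv /= andbT.
Qed.

End random_field.

(** * The Euclidean norm, the index filter and the limit set *)

Lemma enorm_continuous (R : realType) n : continuous (@enorm R n).
Proof.
move=> x; rewrite /enorm; apply: (@continuous_comp _ _ _
  (fun x : 'cV[R]_n => \sum_(i < n) x i ord0 ^+ 2) Num.sqrt).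
  apply: continuous_big => [|i _ y]; first exact: add_continuous.
  apply: (@continuous_comp _ _ _ (fun x : 'cV[R]_n => x i ord0)
    (fun z : R => z ^+ 2)); first exact: coord_continuous.
  exact: exprn_continuous.
exact: sqrt_continuous.
Qed.

Lemma enorm_ge0 (R : realType) n (x : 'cV[R]_n) : 0 <= enorm x.
Proof. exact: sqrtr_ge0. Qed.

Lemma enorm0 (R : realType) n : enorm (0 : 'cV[R]_n) = 0.
Proof.
by rewrite /enorm big1 ?sqrtr0 // => i _; rewrite mxE expr0n.
Qed.

(** With the continuity of enorm, the only comparison between the two norms
    that the proof relies on: Euclidean closeness implies closeness for the
    max norm, whose balls define the topology. *)
Lemma norm_le_enorm (R : realType) n (x : 'cV[R]_n) : `|x| <= enorm x.
Proof.
rewrite [leLHS]/Num.norm /= mx_normrE; apply/bigmax_leP; split.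
  exact: enorm_ge0.
move=> [i j] _ /=.
rewrite (ord1 j) -sqrtr_sqr ler_sqrt ?sumr_ge0 //; last first.
  by move=> k _; rewrite sqr_ge0.
by rewrite (bigD1 i) //= lerDl sumr_ge0 // => k _; rewrite sqr_ge0.
Qed.

Lemma eball_open (R : realType) n (r : R) : open (@eball R n r).
Proof.
rewrite (_ : @eball R n r = @enorm R n @^-1` `]-oo, r[).
  by move/continuousP: (@enorm_continuous R n); apply; exact: interval_open.
by apply/seteqP; split => x; rewrite /eball /= in_itv.
Qed.

Lemma trmx_continuous (R : realType) m n :
  continuous (trmx : 'M[R]_(m, n) -> 'M[R]_(n, m)).
Proof.
move=> x A /nbhs_ballP[e /= e0 eA]; apply/nbhs_ballP; exists e => //= y [_ h].
by apply: eA; split => // i j; rewrite !mxE; exact: h.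
Qed.

(** Heine-Borel for row vectors, transported by transposition. *)
Lemma compact_closure_eball (R : realType) n (r : R) :
  compact (closure (@eball R n r)).
Proof.
set K := closure _.
have Kle x : K x -> `|x| <= r.
  move=> Kx; have cB : closed [set x : 'cV[R]_n | `|x| <= r].
    rewrite (_ : [set x | _] = Num.norm @^-1` `]-oo, r]).
      apply: closed_comp => [y _|]; last exact: interval_closed.
      exact: norm_continuous.
    by apply/seteqP; split => y; rewrite /= in_itv.
  apply: cB; apply: closure_subset Kx => y; rewrite /eball /= => h.
  by apply: (le_trans (norm_le_enorm y)); exact: ltW.
pose K' := (trmx : 'rV[R]_n -> 'cV[R]_n) @^-1` K.
have cK' : compact K'.
  apply: bounded_closed_compact.
    exists r; split; first exact: num_real.
    move=> M rM y K'y; apply: le_trans (ltW rM); apply: le_trans (Kle _ K'y).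
    rewrite /Num.norm /= !mx_normrE; apply/bigmax_leP; split.
      by rewrite -mx_normrE; exact: (normr_ge0 (y^T)).
    move=> [i j] _ /=; apply/bigmax_geP; right; exists (j, i) => //=.
    by rewrite mxE.
  apply: closed_comp => [y _|]; last exact: closed_closure.
  exact: trmx_continuous.
have -> : K = (trmx : 'rV[R]_n -> 'cV[R]_n) @` K'.
  apply/seteqP; split => [x Kx|_ [y K'y <-] //].
  by exists x^T; rewrite /K' /= trmxK.
apply: continuous_compact cK'.
by apply: continuous_subspaceT; exact: trmx_continuous.
Qed.

Lemma compact_sub_eball (R : realType) n (K : set 'cV[R]_n) :
  compact K -> exists r, forall r', r <= r' -> K `<=` eball r'.
Proof.
move=> cK; have cE : compact (@enorm R n @` K).
  apply: continuous_compact cK.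
  by apply: continuous_subspaceT; exact: enorm_continuous.
have [M [_ hM]] := compact_bounded cE.
exists (M + 1 + 1) => r' Mr' x Kx.
have : `|enorm x| <= M + 1 by apply: hM; [rewrite ltrDl|exists x].
by rewrite /eball /= ger0_norm ?enorm_ge0 // => h; lra.
Qed.

Lemma at_inftyP (R : realType) (TT : set R) (P : set R) :
  at_infty TT P <-> exists M, forall t, M < t -> TT t -> P t.
Proof.
split=> [[M [_ h]]|[M h]]; exists M; first by move=> t /h.
by split; [exact: num_real|move=> t /h].
Qed.

#[global] Instance at_infty_filter (R : realType) (TT : set R) :
  Filter (at_infty TT).
Proof. exact: within_filter. Qed.

(** The index set is unbounded, so it meets every neighbourhood of +oo. *)
Lemma at_infty_proper (R : realType) (TT : set R) :
  ereal_sup [set t%:E | t in TT] = +oo%E -> ProperFilter (at_infty TT).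
Proof.
move=> TTy; split; last exact: at_infty_filter.
move=> /at_inftyP[M h].
have /ereal_sup_gt[_ [t Tt <-]] : (M%:E < ereal_sup [set t%:E | t in TT])%E.
  by rewrite TTy ltry.
by rewrite lte_fin => /h; exact.
Qed.

Section limit_set.
Context (R : realType) (p : nat) (TT : set R) (U_ : R -> set 'cV[R]_p).
Let U := limit_set TT U_.

(** The first of the two properties through which U is used: a point of U is
    eventually approached by U_t.  The second is notin_limit_set. *)
Lemma limit_set_near (u : 'cV[R]_p) (e : R) : U u -> 0 < e ->
  \forall t \near at_infty TT, exists2 y, U_ t y & ball u e y.
Proof.
move=> Uu e0; have [N _ h] := Uu e e0.
apply/at_inftyP; exists N%:R => t Nt Tt.
have /ereal_inf_lt[_ [y Uy <-]] := h t (conj Tt (ltW Nt)).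
rewrite lte_fin => uy; exists y => //.
by rewrite -ball_normE /= (le_lt_trans (norm_le_enorm _)).
Qed.

Hypothesis A3 : \bigcap_(N in [set N : nat | (0 < N)%N])
  closure (\bigcup_(t in tail TT N%:R) U_ t) `<=` U.

(** The contrapositive of A3. *)
Lemma notin_limit_set (x : 'cV[R]_p) : ~ U x ->
  exists2 r : R, 0 < r &
    \forall t \near at_infty TT, forall y, ball x r y -> ~ U_ t y.
Proof.
move=> nUx; apply: contrapT => nex; apply: nUx; apply: A3 => N _ B.
move=> /nbhs_ballP[r /= r0 rB]; apply: contrapT => nB; apply: nex.
exists r => //; apply/at_inftyP; exists N%:R => t Nt Tt y xy Uy; apply: nB.
by exists y; split; [exists t => //; split => //; exact: ltW|exact: rB].
Qed.

(** A point outside U has a ball eventually disjoint from U_t, whereas the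
    points of U in that ball are eventually approached by U_t. *)
Lemma limit_set_closed : ProperFilter (at_infty TT) -> closed U.
Proof.
move=> FF x clx; apply: contrapT => /notin_limit_set[r r0 near_r].
have r20 : 0 < r / 2 by rewrite divr_gt0.
have [u [Uu xu]] := clx _ (nbhsx_ballx x _ r20).
have [t [h1 [y Uy uy]]] := filter_ex (filterI near_r (limit_set_near Uu r20)).
by apply: (h1 y) Uy; exact: ball_split xu uy.
Qed.

(** Compactness makes limit_set_near uniform: near x, either U has a point,
    whose approximants serve all its neighbours, or there is nothing to show. *)
Lemma limit_set_inner (K : set 'cV[R]_p) (e : R) : compact K -> 0 < e ->
  \forall t \near at_infty TT, forall u, K u -> U u ->
    exists2 y, U_ t y & ball u e y.
Proof.
move=> /compact_near_coveringP cK e0.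
apply: (cK R (at_infty TT)
  (fun t u => U u -> exists2 y, U_ t y & ball u e y)) => x Kx.
have e30 : 0 < e / 3 by rewrite divr_gt0.
have [[u Uu xu]|nu] := pselect (exists2 u, U u & ball x (e / 3) u); last first.
  exists (ball x (e / 3), setT).
    by split; [exact: nbhsx_ballx|exact: filterT].
  by move=> [y t] /= [xy _] Uy; exfalso; apply: nu; exists y.
exists (ball x (e / 3), [set t | exists2 y, U_ t y & ball u (e / 3) y]).
  by split; [exact: nbhsx_ballx|exact: limit_set_near].
move=> [y t] /= [xy [z Uz uz]] _; exists z => //.
have -> : e = e / 3 + e / 3 + e / 3 by lra.
by apply: ball_triangle uz; apply: ball_triangle xu; exact: ball_sym.
Qed.

(** Compactness makes notin_limit_set uniform: in a bounded region U_t is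
    eventually contained in any thickening of U. *)
Lemma limit_set_outer (K : set 'cV[R]_p) (e : R) : compact K -> 0 < e ->
  \forall t \near at_infty TT, forall x, K x -> U_ t x ->
    exists2 u, U u & ball x e u.
Proof.
move=> /compact_near_coveringP cK e0.
apply: (cK R (at_infty TT)
  (fun t x => U_ t x -> exists2 u, U u & ball x e u)) => x Kx.
have [Ux|/notin_limit_set[r r0 nr]] := pselect (U x).
  exists (ball x e, setT); first by split; [exact: nbhsx_ballx|exact: filterT].
  by move=> [y t] /= [xy _] _; exists x => //; exact: ball_sym.
exists (ball x r, [set t | forall y, ball x r y -> ~ U_ t y]).
  by split; [exact: nbhsx_ballx|].
by move=> [y t] /= [xy h] Uy; have := h y xy.
Qed.

End limit_set.

(** * Near-maximizers and their limits *)

Section near_argmax.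
Context (R : realType) (T : pseudoMetricType R).
Variables (U D : set T).

Definition near_argmax (e : R) (f : T -> R) (v : T) :=
  [/\ D v, (exists2 u, U u & ball v e u) &
      forall u, U u -> ball u e `<=` D ->
        exists2 x, ball u e x & f x <= f v + e].

Lemma near_argmaxW (e e' : R) f v : e <= e' ->
  near_argmax e f v -> near_argmax e' f v.
Proof.
move=> ee' [Dv [u Uu vu] h]; split => //.
  by exists u => //; exact: le_ball vu.
move=> y Uy yD; have [|x yx fx] := h y Uy.
  exact: subset_trans (le_ball ee') yD.
by exists x; [exact: le_ball yx|lra].
Qed.

(** Comparing f with s at x and at v costs e each, and s x <= s v + e. *)
Lemma near_argmax_perturb (e : R) f s v :
  (forall x, D x -> `|f x - s x| < e) ->
  near_argmax e s v -> near_argmax (3 * e) f v.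
Proof.
move=> fs [Dv [u Uu vu] h].
have e0 : 0 < e by rewrite (le_lt_trans _ (fs v Dv)).
have le3 : e <= 3 * e by lra.
split => //; first by exists u => //; exact: le_ball vu.
move=> y Uy yD; have eD : ball y e `<=` D.
  by apply: subset_trans yD; exact: le_ball.
have [x yx sx] := h y Uy eD; exists x; first exact: le_ball yx.
have := fs _ Dv; have := fs _ (eD _ yx); rewrite !ltr_distlC.
by move=> /andP[? ?] /andP[? ?]; lra.
Qed.

(** If f u exceeded f v, continuity would keep f close to f u on a small ball
    around u and close to f v near v, against near-maximality at small scale. *)
Lemma near_argmax_closed (f : T -> R) (v : T) :
  closed U -> open D -> continuous f ->
  (forall r, 0 < r -> exists2 y, ball v r y & near_argmax r f y) ->
  U v /\ forall u, U u -> D u -> f u <= f v.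
Proof.
move=> cU oD cf h; split.
  apply: cU => B /nbhs_ballP[r /= r0 rB].
  have r20 : 0 < r / 2 by rewrite divr_gt0.
  have [y vy [_ [u Uu yu] _]] := h _ r20.
  by exists u; split => //; apply: rB; apply: ball_split vy yu.
move=> u Uu Du; rewrite leNgt; apply/negP => fvu.
have [c c0 cE] : exists2 c, 0 < c & 4 * c = f u - f v.
  by exists ((f u - f v) / 4); lra.
have near_f x : exists2 r : R, 0 < r & forall y, ball x r y -> `|f x - f y| < c.
  have /cvgrPdist_lt/(_ _ c0)/nbhs_ballP[r /= r0 xr] := cf x.
  by exists r.
have [r1 r10 h1] := near_f u; have [r2 r20 h2] := near_f v.
have /nbhs_ballP[r3 /= r30 h3] := open_nbhs_nbhs (conj oD Du).
(* Small enough for both continuity estimates, for ball u r to stay in D, and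
   for the error term r to be at most a quarter of the gap. *)
pose r := Num.min (Num.min r1 r2) (Num.min r3 c).
have r0 : 0 < r by rewrite /r !lt_min r10 r20 r30 c0.
have [rr1 rr2 rr3 rc] : [/\ r <= r1, r <= r2, r <= r3 & r <= c].
  by rewrite /r !ge_min !lexx !orbT.
have [y vy [_ _ hy]] := h _ r0.
have [|x ux fx] := hy u Uu; first exact: subset_trans (le_ball rr3) h3.
have := h1 x (le_ball rr1 ux); have := h2 y (le_ball rr2 vy).
rewrite !ltr_distlC => /andP[? ?] /andP[? ?].
by lra.
Qed.

(** The pairs of near-maximizers at scale 1/(n+1) stay in the compact set
    K * K, and any of their cluster points has the required properties. *)
Lemma near_argmax_cluster (K : set T) (f : T -> R) (phi : T * T -> R) (m : R) :
  closed U -> open D -> compact K -> D `<=` K ->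
  continuous f -> continuous phi ->
  (forall e, 0 < e -> exists v v',
    [/\ near_argmax e f v, near_argmax e f v' & m <= phi (v, v')]) ->
  exists v v', [/\ U v /\ (forall u, U u -> D u -> f u <= f v),
    U v' /\ (forall u, U u -> D u -> f u <= f v') & m <= phi (v, v')].
Proof.
move=> cU oD cK DK cf cphi h.
have ex (n : nat) : exists z : T * T,
    [/\ near_argmax n.+1%:R^-1 f z.1, near_argmax n.+1%:R^-1 f z.2 &
        m <= phi z].
  have n0 : 0 < n.+1%:R^-1 :> R by rewrite invr_gt0 ltr0n.
  by have [v [v' []]] := h _ n0; exists (v, v').
pose z n := projT1 (cid (ex n)).
have zP n : [/\ near_argmax n.+1%:R^-1 f (z n).1,
    near_argmax n.+1%:R^-1 f (z n).2 & m <= phi (z n)].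
  exact: projT2 (cid (ex n)).
have [|[v v'] [_ clv]] :=
  compact_setX cK cK (fmap_proper_filter z eventually_filter).
  by exists 0%N => // n _; have [[? _ _] [? _ _] _] := zP n; split; exact: DK.
have clP (r : R) (B : set (T * T)) : 0 < r -> nbhs (v, v') B -> exists n,
    n.+1%:R^-1 <= r /\ B (z n).
  move=> r0 nB; have [N Nr] := exists_invS_lt r0.
  have [|_ [[n /= Nn <-] Bn]] := clv (z @` [set n | (N <= n)%N]) B _ nB.
    by exists N => // n Nn; exists n.
  exists n; split => //; apply: le_trans (ltW Nr).
  by rewrite lef_pV2 ?posrE ?ltr0n // ler_nat.
have nball (r : R) : 0 < r ->
    nbhs (v, v') [set y | ball v r y.1 /\ ball v' r y.2].
  move=> r0; exists (ball v r, ball v' r); first by split; exact: nbhsx_ballx.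
  by move=> y [].
exists v, v'; split.
- apply: near_argmax_closed => // r r0.
  have [n [nr [vn _]]] := clP r _ r0 (nball r r0).
  by exists (z n).1 => //; have [h1 _ _] := zP n; exact: near_argmaxW h1.
- apply: near_argmax_closed => // r r0.
  have [n [nr [_ vn]]] := clP r _ r0 (nball r r0).
  by exists (z n).2 => //; have [_ h1 _] := zP n; exact: near_argmaxW h1.
- rewrite leNgt; apply/negP => lt_m.
  have /cvgrPdist_lt/(_ (m - phi (v, v'))) := cphi (v, v').
  rewrite subr_gt0 => /(_ lt_m) /(clP 1 _ ltr01)[n [_]].
  have [_ _ mz] := zP n; rewrite ltr_distlC => /andP[_].
  by move: mz; lra.
Qed.

(** The tent functional over all triples (s, v, v') with v and v'
    near-maximizers of s, weighted by phi (v, v').  It dominates phi at the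
    near-maximizers of f, and it is positive only where f is uniformly close to
    such an s, whose near-maximizers are near-maximizers of f at scale 3 e. *)
Lemma argmax_test (K : set T) (phi : T * T -> R) (e : R) :
  D `<=` K -> 0 < e -> (forall z, 0 <= phi z <= 1) ->
  exists g : Cspace (set_type K) R -> R,
    [/\ unif_continuous_on setT g, (forall f, 0 <= g f <= 1),
        (forall (f : Cspace T R) v v', near_argmax e f v ->
           near_argmax e f v' -> phi (v, v') <= g (Crestrict K f)) &
        (forall (f : Cspace T R) (m : R), 0 <= m -> m < g (Crestrict K f) ->
           exists v v', [/\ near_argmax (3 * e) f v,
             near_argmax (3 * e) f v' & m < phi (v, v')])].
Proof.
move=> DK e0 phi01.
pose A (i : Cspace T R * (T * T)) :=
  near_argmax e i.1 i.2.1 /\ near_argmax e i.1 i.2.2.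
have [g [ug g01 gA gm]] := @bump_functional (set_type K) R _ A
  (fun i x => i.1 (set_val x)) (fun i => phi i.2) e e0 (fun i => phi01 i.2).
exists g; split => //.
  by move=> f v v' fv fv'; apply: (gA (f, (v, v'))).
move=> f m m0 mg; have [[s [v v']] [[sv sv'] mv fs]] := gm _ _ m0 mg.
have fsD x : D x -> `|f x - s x| < e.
  by move=> Dx; exact: (fs (SigSub (mem_set (DK _ Dx)))).
by exists v, v'; split => //; apply: near_argmax_perturb; eauto.
Qed.

(** Otherwise f would have, at arbitrarily small scales, near-maximizers v, v'
    with phi (v, v') > phi (u0, u0) + eta; their cluster points maximize f,
    hence are equal to u0. *)
Lemma argmax_test_limit (K : set T) (phi : T * T -> R)
    (g : R -> Cspace (set_type K) R -> R) (f : Cspace T R) (u0 : T) (eta : R) :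
  closed U -> open D -> compact K -> D `<=` K -> continuous phi ->
  (forall z, 0 <= phi z) ->
  (forall e (m : R), 0 < e -> 0 <= m -> m < g e (Crestrict K f) ->
     exists v v', [/\ near_argmax (3 * e) f v,
       near_argmax (3 * e) f v' & m < phi (v, v')]) ->
  D u0 -> U u0 -> (forall u, U u -> u <> u0 -> f u < f u0) -> 0 < eta ->
  exists2 e0 : R, 0 < e0 & forall e, 0 < e -> e <= e0 ->
    g e (Crestrict K f) <= phi (u0, u0) + eta.
Proof.
move=> cU oD cK DK cphi phi0 hg Du0 Uu0 fu0 eta0; apply: contrapT => nex.
have m0 : 0 <= phi (u0, u0) + eta by rewrite addr_ge0 // ltW.
have [|v [v' [[Uv vmax] [Uv' vmax'] ]]] := @near_argmax_cluster K f phi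
    (phi (u0, u0) + eta) cU oD cK DK (@cts_fun _ _ f) cphi.
  move=> e e0.
  have e30 : 0 < e / 3 by rewrite divr_gt0.
  have [e1 [e10 e1e mg]] : exists e1, [/\ 0 < e1, e1 <= e / 3 &
      phi (u0, u0) + eta < g e1 (Crestrict K f)].
    apply: contrapT => nex1; apply: nex; exists (e / 3) => // e1 e10 e1e.
    by rewrite leNgt; apply/negP => mg; apply: nex1; exists e1.
  have [v [v' [h1 h2 h3]]] := hg _ _ e10 m0 mg.
  have le3 : 3 * e1 <= e by lra.
  exists v, v'; split; last exact: ltW.
    exact: near_argmaxW h1.
  exact: near_argmaxW h2.
have -> : v = u0.
  by apply: contrapT => /(fu0 _ Uv); rewrite ltNge (vmax _ Uu0 Du0).
have -> : v' = u0.
  by apply: contrapT => /(fu0 _ Uv'); rewrite ltNge (vmax' _ Uu0 Du0).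
by rewrite gerDl leNgt eta0.
Qed.

End near_argmax.

(** * Means of bounded random variables *)

Section bounded_measurable.
Context d (Omega : measurableType d) (R : realType) (P : probability Omega R).
Implicit Types X Y : Omega -> R.

Definition bounded_rv X :=
  measurable_fun [set: Omega] X /\ exists M, forall w, `|X w| <= M.

Lemma bounded_rv_cst (c : R) : bounded_rv (fun=> c).
Proof. by split; [exact: measurable_cst|exists `|c|]. Qed.

Lemma bounded_rvD X Y :
  bounded_rv X -> bounded_rv Y -> bounded_rv (fun w => X w + Y w).
Proof.
move=> [mX [M XM]] [mY [N YN]]; split; first exact: measurable_funD.
by exists (M + N) => w; rewrite (le_trans (ler_normD _ _)) // lerD.
Qed.

Lemma bounded_rvM X Y :
  bounded_rv X -> bounded_rv Y -> bounded_rv (fun w => X w * Y w).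
Proof.
move=> [mX [M XM]] [mY [N YN]]; split; first exact: measurable_funM.
by exists (M * N) => w; rewrite normrM ler_pM.
Qed.

Lemma bounded_rv_indic (A : set Omega) : measurable A -> bounded_rv \1_A.
Proof.
move=> mA; split; first exact: measurable_indic.
by exists 1 => w; rewrite indicE; case: (_ \in _); rewrite ?normr1 ?normr0.
Qed.

Lemma bounded_rv01 X : measurable_fun setT X -> (forall w, 0 <= X w <= 1) ->
  bounded_rv X.
Proof.
by move=> mX X01; split=> //; exists 1 => w; have /andP[? ?] := X01 w;
  rewrite ger0_norm.
Qed.

Lemma bounded_rv_integrable X : bounded_rv X ->
  P.-integrable setT (EFin \o X).
Proof.
move=> [mX [M XM]]; apply: measurable_bounded_integrable => //.
  exact: le_lt_trans (probability_le1 P measurableT) (ltry 1).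
exists M; split; first exact: num_real.
by move=> r Mr w _ /=; apply: le_trans (XM w) (ltW Mr).
Qed.

Definition mean X : R := \int[P]_w X w.

Lemma expectationE X : bounded_rv X -> ('E_P[X] = (mean X)%:E)%E.
Proof.
move=> bX; rewrite unlock /mean /Rintegral fineK //.
exact: integrable_fin_num (bounded_rv_integrable bX).
Qed.

Lemma meanD X Y : bounded_rv X -> bounded_rv Y ->
  mean (fun w => X w + Y w) = mean X + mean Y.
Proof.
by move=> bX bY; apply: RintegralD => //; exact: bounded_rv_integrable.
Qed.

Lemma meanZ c X : bounded_rv X -> mean (fun w => c * X w) = c * mean X.
Proof.
by move=> bX; apply: RintegralZl => //; exact: bounded_rv_integrable.
Qed.

Lemma mean_cst c : mean (fun=> c) = c.
Proof.
transitivity (c * fine (P setT)); first exact: Rintegral_cst.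
by rewrite probability_setT mulr1.
Qed.

Lemma mean_indic (A : set Omega) : measurable A -> mean \1_A = fine (P A).
Proof. by move=> mA; rewrite /mean /Rintegral integral_indic // setIT. Qed.

Lemma le_mean X Y : bounded_rv X -> bounded_rv Y ->
  (forall w, X w <= Y w) -> mean X <= mean Y.
Proof.
by move=> bX bY XY; apply: le_Rintegral => //; exact: bounded_rv_integrable.
Qed.

Lemma mean_indic_le (A : set Omega) (e : R) :
  measurable A -> (P A <= e%:E)%E -> mean \1_A <= e.
Proof.
move=> mA PA; rewrite mean_indic // -lee_fin fineK //.
exact: fin_num_measure.
Qed.

(** Dominated convergence with the constant 1 as dominating function. *)
Lemma mean_cvg0 (h : nat -> Omega -> R) :
  (forall n, measurable_fun setT (h n)) -> (forall n w, 0 <= h n w <= 1) ->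
  {ae P, forall w, h ^~ w @ \oo --> (0 : R)} ->
  (fun n => mean (h n)) @ \oo --> (0 : R).
Proof.
move=> mh h01 h0.
have cv0 : {ae P, forall w, [set: Omega] w ->
    (fun n => (h n w)%:E) @ \oo --> 0%E}.
  by apply: filterS h0 => w hw _; apply: cvg_EFin hw; exact: nearW.
have le1 : {ae P, forall w n, [set: Omega] w -> (`|(h n w)%:E| <= 1%:E)%E}.
  apply: aeW => w n _; have /andP[? ?] := h01 n w.
  by rewrite lee_fin ger0_norm.
have [_ _] := @dominated_convergence _ Omega R P setT measurableT
  (fun n w => (h n w)%:E) (cst 0%E) (cst 1%E)
  (fun n => (measurable_EFinP _ _).2 (mh n)) (measurable_cst _) cv0
  (bounded_rv_integrable (bounded_rv_cst 1)) le1.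
by rewrite integral0 => /fine_cvg.
Qed.

(** The indicators of the decreasing events n <= X tend to 0 everywhere. *)
Lemma probability_tail (X : Omega -> R) (e : R) :
  measurable_fun setT X -> 0 < e ->
  exists r0, forall r, r0 <= r -> (P [set w | (r <= X w)%R] <= e%:E)%E.
Proof.
move=> mX e0.
have mXr r : measurable [set w | r <= X w].
  have := mX measurableT `[r, +oo[%classic (measurable_itv _).
  by rewrite setTI; apply: measurable_ext => w; rewrite /= in_itv /= andbT.
have := @mean_cvg0 (fun n => \1_[set w | n%:R <= X w])
  (fun n => (bounded_rv_indic (mXr _)).1).
have h01 n w : 0 <= (\1_[set w | n%:R <= X w] w : R) <= 1.
  by rewrite indicE; case: (_ \in _); rewrite /= ?ler01 ?lexx.
move=> /(_ h01) cv; have /cv : {ae P, forall w,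
    (fun n => \1_[set w | n%:R <= X w] w : R) @ \oo --> (0 : R)}.
  apply: aeW => w; apply: cvg_near_cst.
  exists (Num.truncn (X w)).+1 => // n /= Xn.
  rewrite indicE memNset //= => nX.
  have : X w < n%:R by rewrite (lt_le_trans (truncnS_gt _)) // ler_nat.
  by rewrite ltNge nX.
move=> /cvgrPdist_le/(_ e e0)[N _ /(_ N (leqnn N))].
rewrite sub0r normrN mean_indic // => hN.
exists N%:R => r Nr; apply: (@le_trans _ _ (P [set w | N%:R <= X w])).
  by apply: le_measure; rewrite ?inE //; move=> w /=; exact: le_trans.
rewrite -(@fineK _ (P _)) ?fin_num_measure // lee_fin.
exact: le_trans (ler_norm _) hN.
Qed.
End bounded_measurable.

(** * The argmax theorem for near-maximizers under stable convergence *)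

(** Multiplication by the weight z in [0, 1] keeps a bound with nonnegative
    error terms. *)
Lemma weighted_le (R : realType) (g f a y z : R) :
  0 <= z <= 1 -> 0 <= a -> 0 <= y -> g - f - a <= y ->
  g * z <= f * z + a + y.
Proof. by move=> /andP[? ?] *; nra. Qed.

Lemma le_add3 (R : realType) (x a b c : R) :
  0 <= a -> 0 <= c -> x <= b -> x <= a + b + c.
Proof. by lra. Qed.

Lemma chain_le (R : realType) (x g b1 b2 g' f a h eta : R) :
  x <= g + b1 + b2 -> b1 <= eta -> b2 <= eta -> g <= g' + eta ->
  g' <= f + a + h -> a <= eta -> h <= eta -> x <= f + 5 * eta.
Proof. by lra. Qed.

Section stable_argmax.
Context d (Omega : measurableType d) (R : realType) (P : probability Omega R).
Variable G : set (set Omega).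
Hypothesis G_sigma : sigma_algebra [set: Omega] G.
Hypothesis G_sub : G `<=` [set A | measurable A].
Context (I : Type) (F : set_system I) {FF : Filter F}.

Lemma measurable_wrt_fun (Z : Omega -> R) :
  measurable_wrt G Z -> measurable_fun setT Z.
Proof. by move=> GZ _ B mB; rewrite setTI; exact/G_sub/GZ. Qed.

Lemma stable_cvg_mean_le (S : topologicalType) (Y_ : I -> Omega -> S)
    (Y : Omega -> S) (g : S -> R) (zeta : Omega -> R) (e : R) :
  stable_cvg P G F Y_ Y -> continuous g -> (forall s, 0 <= g s <= 1) ->
  measurable_wrt G zeta -> (forall w, 0 <= zeta w <= 1) ->
  (\forall t \near F, measurable_fun setT (g \o Y_ t)) ->
  measurable_fun setT (g \o Y) -> 0 < e ->
  \forall t \near F, mean P (fun w => g (Y_ t w) * zeta w) <=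
                     mean P (fun w => g (Y w) * zeta w) + e.
Proof.
move=> sY cg g01 Gz z01 mY_ mY e0.
have bz : bounded_rv zeta.
  by apply: bounded_rv01 => //; exact: measurable_wrt_fun.
have bdd (T : Type) (h : T -> R) : (forall x, 0 <= h x <= 1) -> bounded_fun h.
  move=> h01; exists 1; split; first exact: num_real.
  move=> M M1 x _ /=; have /andP[? ?] := h01 x.
  by rewrite ger0_norm // (le_trans _ (ltW M1)).
have := sY g zeta cg (bdd _ _ g01) Gz (bdd _ _ z01).
rewrite (@expectationE _ _ _ P (fun w => g (Y w) * zeta w)); last first.
  by apply: bounded_rvM => //; apply: bounded_rv01.
move=> /fine_cvg /cvgrPdist_le/(_ e e0); apply: filterS2 mY_ => t mt.
rewrite /= expectationE; last by apply: bounded_rvM => //; exact: bounded_rv01.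
by rewrite /= ler_distlC => /andP[].
Qed.

Context (p : nat) (U : set 'cV[R]_p).
Variable V : I -> Omega -> Cspace 'cV[R]_p R.
Variable Z : Omega -> Cspace 'cV[R]_p R.
Hypothesis V_rv : \forall t \near F, random_element (V t).
Hypothesis Z_rv : random_element Z.
Hypothesis VZ : forall r : R, 0 < r -> stable_cvg P G F
  (fun t w => Crestrict (closure (eball r)) (V t w))
  (fun w => Crestrict (closure (eball r)) (Z w)).
Variable uhat : Omega -> 'cV[R]_p.
Hypothesis U_closed : closed U.
Hypothesis uhat_rv : random_element uhat.
Hypothesis uhat_in : forall w, U (uhat w).
Hypothesis uhat_max : {ae P, forall w, forall u, U u -> u <> uhat w ->
  Z w u < Z w (uhat w)}.

(** The window is a large ball whose radius may depend on eta; the scale e is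
    then arbitrary.  The exceptional event is required to be contained in a
    measurable one of small probability, so that near-maximality itself need not
    define a measurable event. *)
Definition asymptotic_argmax (X : I -> Omega -> 'cV[R]_p) :=
  forall eta : R, 0 < eta -> exists r0 : R, forall r, r0 <= r ->
    forall e : R, 0 < e -> \forall t \near F,
      exists2 B, measurable B /\ (P B <= eta%:E)%E &
        forall w, ~ B w -> near_argmax U (eball r) e (V t w) (X t w).

Lemma measurable_fun_pair (X Y : Omega -> 'cV[R]_p)
    (phi : 'cV[R]_p * 'cV[R]_p -> R) :
  random_element X -> random_element Y -> continuous phi ->
  measurable_fun setT (fun w => phi (X w, Y w)).
Proof.
move=> mX mY cphi.
apply: (@measurable_random_field_comp _ _ _ ('cV[R]_p * 'cV[R]_p)%type setT
  (fun _ => phi) _ _ _ (fun w => (X w, Y w))) => //.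
- by apply: separable_prod; exact: separable_cV.
- by move=> w; exact: continuous_subspaceT.
- move=> [x y] e.
  have := measurableI _ _ (random_element_ball x e mX)
    (random_element_ball y e mY).
  by apply: measurable_ext => w.
Qed.

(** The exceptional events of X and Y, the escape of uhat from the window, the
    passage to the limit in t and the passage to the limit in e each cost at
    most eta = eps / 5. *)
Lemma limsup_mean_argmax_pair (X Y : I -> Omega -> 'cV[R]_p)
    (phi : 'cV[R]_p * 'cV[R]_p -> R) (zeta : Omega -> R) (eps : R) :
  asymptotic_argmax X -> asymptotic_argmax Y ->
  (\forall t \near F, random_element (X t)) ->
  (\forall t \near F, random_element (Y t)) ->
  continuous phi -> (forall z, 0 <= phi z <= 1) ->
  measurable_wrt G zeta -> (forall w, 0 <= zeta w <= 1) -> 0 < eps ->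
  \forall t \near F, mean P (fun w => phi (X t w, Y t w) * zeta w) <=
    mean P (fun w => phi (uhat w, uhat w) * zeta w) + eps.
Proof.
move=> aX aY X_rv Y_rv cphi phi01 Gz z01 eps0.
have bz : bounded_rv zeta.
  by apply: bounded_rv01 => //; exact: measurable_wrt_fun.
pose eta := eps / 5; have eta0 : 0 < eta by rewrite divr_gt0.
have [r1 h1] := aX _ eta0; have [r2 h2] := aY _ eta0.
have menorm : measurable_fun setT (fun w => enorm (uhat w)).
  exact: (random_element_fun uhat_rv (@enorm_continuous R p)).
have [r3 h3] := probability_tail P menorm eta0.
pose r := Num.max (Num.max r1 r2) (Num.max r3 1).
have [rr1 rr2 rr3 r0] : [/\ r1 <= r, r2 <= r, r3 <= r & 0 < r].
  by rewrite /r !le_max !lexx !orbT !lt_max ltr01 !orbT.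
pose D := @eball R p r; pose K := closure D.
have cK : compact K by exact: compact_closure_eball.
have DK : D `<=` K by exact: subset_closure.
have oD : open D by exact: eball_open.
have cKT : compact [set: set_type K] by exact: compact_set_type.
have exg (e : R) : exists g : Cspace (set_type K) R -> R, 0 < e ->
    [/\ unif_continuous_on setT g, (forall f, 0 <= g f <= 1),
      (forall (f : Cspace 'cV[R]_p R) v v', near_argmax U D e f v ->
         near_argmax U D e f v' -> phi (v, v') <= g (Crestrict K f)) &
      (forall (f : Cspace 'cV[R]_p R) (m : R), 0 <= m ->
         m < g (Crestrict K f) -> exists v v',
         [/\ near_argmax U D (3 * e) f v, near_argmax U D (3 * e) f v' &
             m < phi (v, v')])].
  have [e0|ne0] := pselect (0 < e); last by exists (fun=> 0).
  by have [g ?] := @argmax_test R _ U D K phi e DK e0 phi01; exists g.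
pose g e := projT1 (cid (exg e)).
have gP e : 0 < e -> _ := projT2 (cid (exg e)).
have mg e (W : Omega -> Cspace 'cV[R]_p R) : 0 < e -> random_element W ->
    measurable_fun setT (fun w => g e (Crestrict K (W w))).
  move=> /gP[ug _ _ _] mW.
  apply: (random_element_fun mW (f := g e \o Crestrict K)).
  by apply: (unif_continuous_onW cK); exact: unif_continuous_on_restrict.
pose A := [set w | r <= enorm (uhat w)].
have mA : measurable A.
  have := menorm measurableT `[r, +oo[%classic (measurable_itv _).
  by rewrite setTI; apply: measurable_ext => w; rewrite /= in_itv /= andbT.
have n0 n : 0 < n.+1%:R^-1 :> R by rewrite invr_gt0 ltr0n.
pose phiu w := phi (uhat w, uhat w).
have bphiu : bounded_rv phiu.
  by apply: bounded_rv01 => [|w]; [exact: measurable_fun_pair|exact: phi01].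
have bg e (W : Omega -> Cspace 'cV[R]_p R) : 0 < e -> random_element W ->
    bounded_rv (fun w => g e (Crestrict K (W w))).
  move=> e0 mW; apply: bounded_rv01 => [|w]; first exact: mg.
  by have [_ g01 _ _] := gP _ e0; exact: g01.
(* The part of the test functional exceeding its expected limit; where uhat has
   left the window the indicator dominates the functional. *)
pose h n w := Num.max 0 (g n.+1%:R^-1 (Crestrict K (Z w)) - phiu w - \1_A w).
have iA01 w : 0 <= (\1_A w : R) <= 1.
  by rewrite indicE; case: (_ \in _); rewrite /= ?ler01 ?lexx.
have mh n : measurable_fun setT (h n).
  apply: measurable_maxr; first exact: measurable_cst.
  apply: measurable_funB; last exact: measurable_indic.
  by apply: measurable_funB; [exact: (bg _ _ (n0 n) Z_rv).1|exact: bphiu.1].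
have h01 n w : 0 <= h n w <= 1.
  rewrite /h le_max lexx ge_max ler01 /=.
  have [_ g01 _ _] := gP _ (n0 n); have /andP[_ g1] := g01 (Crestrict K (Z w)).
  have /andP[p0 _] := phi01 (uhat w, uhat w); have /andP[i0 _] := iA01 w.
  by rewrite !lerBlDr (le_trans g1) // -[leLHS]addr0 -{1}[1]addr0 !lerD.
have h_cvg0 : {ae P, forall w, h ^~ w @ \oo --> (0 : R)}.
  apply: filterS uhat_max => w wmax; apply/cvgrPdist_le => e e0.
  have [Aw|nAw] := pselect (A w).
    apply: nearW => n; rewrite /h indicE mem_set //= max_l.
      by rewrite subrr normr0 ltW.
    have [_ g01 _ _] := gP _ (n0 n); have /andP[_ g1] := g01 (Crestrict K (Z w)).
    have /andP[p0 _] := phi01 (uhat w, uhat w).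
    by rewrite !lerBlDr (le_trans g1) // add0r lerDl.
  have Du : D (uhat w) by rewrite /D /eball /= ltNge; exact/negP.
  have hg e1 (m : R) : 0 < e1 -> 0 <= m -> m < g e1 (Crestrict K (Z w)) ->
      exists v v', [/\ near_argmax U D (3 * e1) (Z w) v,
        near_argmax U D (3 * e1) (Z w) v' & m < phi (v, v')].
    by move=> /gP[_ _ _]; exact.
  have phi0 z : 0 <= phi z by have /andP[] := phi01 z.
  have [e1 e10 ge1] := @argmax_test_limit R _ U D K phi g (Z w) (uhat w) e
    U_closed oD cK DK cphi phi0 hg Du (uhat_in w) wmax e0.
  have [N Ne1] := exists_invS_lt e10.
  exists N => // n /= Nn; rewrite sub0r normrN ger0_norm; last first.
    by have /andP[] := h01 n w.
  rewrite /h ge_max ltW //= indicE memNset //= subr0 lerBlDl.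
  apply: ge1 => //; apply: le_trans (ltW Ne1).
  by rewrite lef_pV2 ?posrE ?ltr0n // ler_nat.
have /cvgrPdist_le/(_ eta eta0)[N _ /(_ N (leqnn N))] :=
  mean_cvg0 mh h01 h_cvg0.
rewrite sub0r normrN => /(le_trans (ler_norm _)) hN.
have {n0} := n0 N; set e := N.+1%:R^-1 in hN * => e0.
have [ug g01 g_ge _] := gP _ e0.
have near_g : \forall t \near F,
    mean P (fun w => g e (Crestrict K (V t w)) * zeta w) <=
    mean P (fun w => g e (Crestrict K (Z w)) * zeta w) + eta.
  apply: (stable_cvg_mean_le (VZ r0)) => //.
  - exact: unif_continuous_onW ug.
  - by apply: filterS V_rv => t mVt; exact: mg.
  - exact: mg.
have near_B1 := h1 r rr1 e e0; have near_B2 := h2 r rr2 e e0.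
have limit_le : mean P (fun w => g e (Crestrict K (Z w)) * zeta w) <=
    mean P (fun w => phiu w * zeta w) + mean P \1_A + mean P (h N).
  have bh : bounded_rv (h N) by exact: bounded_rv01.
  have bA : bounded_rv (\1_A : Omega -> R) by exact: bounded_rv_indic.
  rewrite -!meanD //; do ?[exact: bounded_rvM|exact: bounded_rvD|
    apply: bounded_rvD => //; exact: bounded_rvM].
  apply: le_mean.
  - by apply: bounded_rvM => //; exact: bg.
  - by apply: bounded_rvD => //; apply: bounded_rvD => //; exact: bounded_rvM.
  move=> w; have /andP[i0 _] := iA01 w; have /andP[hw0 _] := h01 N w.
  by apply: weighted_le => //; rewrite /h le_max lexx orbT.
have mean_A : mean P \1_A <= eta by apply: mean_indic_le => //; exact: h3.
near=> t.
have mVt : random_element (V t) by near: t.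
have mXt : random_element (X t) by near: t.
have mYt : random_element (Y t) by near: t.
have [B1 [mB1 PB1] B1X] : exists2 B, measurable B /\ (P B <= eta%:E)%E &
  forall w, ~ B w -> near_argmax U D e (V t w) (X t w) by near: t.
have [B2 [mB2 PB2] B2Y] : exists2 B, measurable B /\ (P B <= eta%:E)%E &
  forall w, ~ B w -> near_argmax U D e (V t w) (Y t w) by near: t.
have gt : mean P (fun w => g e (Crestrict K (V t w)) * zeta w) <=
    mean P (fun w => g e (Crestrict K (Z w)) * zeta w) + eta by near: t.
have bgz : bounded_rv (fun w => g e (Crestrict K (V t w)) * zeta w).
  by apply: bounded_rvM => //; exact: bg.
have bB1 : bounded_rv (\1_B1 : Omega -> R) by exact: bounded_rv_indic.
have bB2 : bounded_rv (\1_B2 : Omega -> R) by exact: bounded_rv_indic.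
have prelimit_le : mean P (fun w => phi (X t w, Y t w) * zeta w) <=
    mean P (fun w => g e (Crestrict K (V t w)) * zeta w) +
    mean P \1_B1 + mean P \1_B2.
  rewrite -!meanD //; last exact: bounded_rvD.
  apply: le_mean.
  - apply: bounded_rvM => //; apply: bounded_rv01 => //.
    exact: measurable_fun_pair.
  - by apply: bounded_rvD => //; exact: bounded_rvD.
  move=> w; have /andP[z0 z1] := z01 w.
  have /andP[p0 p1] := phi01 (X t w, Y t w).
  have /andP[gw0 gw1] := g01 (Crestrict K (V t w)).
  have le1 : phi (X t w, Y t w) * zeta w <= 1 by exact: mulr_ile1.
  have gz0 : 0 <= g e (Crestrict K (V t w)) * zeta w by exact: mulr_ge0.
  rewrite !indicE; have [w1|w1] := pselect (B1 w).
    rewrite (mem_set w1); apply: (le_add3 gz0 _ le1).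
    exact: ler0n.
  rewrite (memNset w1); have [w2|w2] := pselect (B2 w).
    by rewrite (mem_set w2) addrAC; exact: (le_add3 gz0 _ le1).
  rewrite (memNset w2) /= !addr0 ler_wpM2r //.
  by apply: g_ge; [exact: B1X|exact: B2Y].
have mean1 := mean_indic_le mB1 PB1; have mean2 := mean_indic_le mB2 PB2.
have -> : eps = 5 * eta by rewrite /eta mulrC divfK.
exact: chain_le prelimit_le mean1 mean2 gt limit_le mean_A hN.
Unshelve. all: by end_near. Qed.

Lemma measurable_wrt_cst (c : R) : measurable_wrt G (fun=> c).
Proof.
have [G0 GC _] := G_sigma; move=> B _; have [Bc|nBc] := pselect (B c).
  rewrite (_ : _ @^-1` _ = setT `\` set0); first exact: GC.
  by rewrite setD0; apply/seteqP; split.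
by rewrite (_ : _ @^-1` _ = set0) //; apply/seteqP; split.
Qed.

Lemma measurable_wrt_comp (h : R -> R) (zeta : Omega -> R) :
  measurable_fun setT h -> measurable_wrt G zeta ->
  measurable_wrt G (h \o zeta).
Proof.
move=> mh Gz B mB; apply: Gz (h @^-1` B) _.
by rewrite -[_ @^-1` _]setTI; exact: mh.
Qed.

(** The upper bound for phi and for 1 - phi. *)
Lemma mean_argmax_cvg (X : I -> Omega -> 'cV[R]_p) (phi : 'cV[R]_p -> R)
    (zeta : Omega -> R) (e : R) :
  asymptotic_argmax X -> (\forall t \near F, random_element (X t)) ->
  continuous phi -> (forall z, 0 <= phi z <= 1) ->
  measurable_wrt G zeta -> (forall w, 0 <= zeta w <= 1) -> 0 < e ->
  \forall t \near F, `|mean P (fun w => phi (X t w) * zeta w) -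
    mean P (fun w => phi (uhat w) * zeta w)| <= e.
Proof.
move=> aX X_rv cphi phi01 Gz z01 e0.
have bz : bounded_rv zeta.
  by apply: bounded_rv01 => //; exact: measurable_wrt_fun.
have bphi (W : Omega -> 'cV[R]_p) : random_element W ->
    bounded_rv (fun w => phi (W w) * zeta w).
  move=> mW; apply: bounded_rvM => //; apply: bounded_rv01 => // .
  exact: random_element_fun mW cphi.
have cphi1 : continuous (fun z : 'cV[R]_p * 'cV[R]_p => phi z.1).
  move=> z; apply: (@continuous_comp _ _ _ fst phi); first exact: cvg_fst.
  exact: cphi.
have cphi2 : continuous (fun z : 'cV[R]_p * 'cV[R]_p => 1 - phi z.1).
  by move=> z; apply: cvgB; [exact: cvg_cst|exact: cphi1].
have upper := limsup_mean_argmax_pair aX aX X_rv X_rv cphi1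
  (fun z => phi01 z.1) Gz z01 e0.
have phi01' (z : 'cV[R]_p * 'cV[R]_p) : 0 <= 1 - phi z.1 <= 1.
  by have /andP[? ?] := phi01 z.1; lra.
have lower := limsup_mean_argmax_pair aX aX X_rv X_rv cphi2 phi01' Gz z01 e0.
have meanN (W : Omega -> 'cV[R]_p) : random_element W ->
    mean P (fun w => (1 - phi (W w)) * zeta w) =
    mean P zeta - mean P (fun w => phi (W w) * zeta w).
  move=> mW; have b := bounded_rvM (bounded_rv_cst Omega (-1)) (bphi _ mW).
  transitivity (mean P (fun w => zeta w + -1 * (phi (W w) * zeta w))).
    by congr (mean P _); apply/funext => w; rewrite mulN1r mulrBl mul1r.
  by rewrite meanD // meanZ ?mulN1r //; exact: bphi.
near=> t.
have mXt : random_element (X t) by near: t.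
have up : mean P (fun w => phi (X t w) * zeta w) <=
    mean P (fun w => phi (uhat w) * zeta w) + e by near: t.
have : mean P (fun w => (1 - phi (X t w)) * zeta w) <=
    mean P (fun w => (1 - phi (uhat w)) * zeta w) + e by near: t.
by rewrite !meanN // => lo; rewrite ler_distlC; lra.
Unshelve. all: by end_near. Qed.

(** An affine change of f and of zeta reduces to values in [0, 1]; the
    additional terms are means of the same form with zeta = 1. *)
Theorem asymptotic_argmax_stable_cvg (X : I -> Omega -> 'cV[R]_p) :
  asymptotic_argmax X -> (\forall t \near F, random_element (X t)) ->
  stable_cvg P G F X uhat.
Proof.
move=> aX X_rv f zeta cf /ex_strict_bound_gt0[M M0 fM] Gz.
move=> /ex_strict_bound_gt0[L L0 zL].
have {}fM x : `|f x| <= M by apply/ltW/fM.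
have {}zL w : `|zeta w| <= L by apply/ltW/zL.
have scale01 (x N : R) : 0 < N -> `|x| <= N -> 0 <= (x / N + 1) / 2 <= 1.
  move=> N0; rewrite ler_norml => /andP[x1 x2].
  have : -1 <= x / N by rewrite ler_pdivlMr // mulN1r.
  have : x / N <= 1 by rewrite ler_pdivrMr // mul1r.
  by move: (x / N) => y ? ?; lra.
pose phi x := (f x / M + 1) / 2; pose z w := (zeta w / L + 1) / 2.
have phi01 x : 0 <= phi x <= 1 by exact: scale01.
have z01 w : 0 <= z w <= 1 by exact: scale01.
have cscale (N : R) : continuous (fun y : R => (y / N + 1) / 2).
  move=> y; apply: cvgM; last exact: cvg_cst.
  by apply: cvgD; [apply: cvgM; [exact: cvg_id|]|]; exact: cvg_cst.
have cphi : continuous phi.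
  move=> x; apply: (@continuous_comp _ _ _ f (fun y => (y / M + 1) / 2)).
    exact: cf.
  exact: cscale.
have Gz' : measurable_wrt G z.
  apply: (@measurable_wrt_comp (fun y => (y / L + 1) / 2)) => //.
  exact: continuous_measurable_fun (cscale L).
have bz : bounded_rv z by apply: bounded_rv01 => //; exact: measurable_wrt_fun.
have bphi (W : Omega -> 'cV[R]_p) : random_element W ->
    bounded_rv (fun w => phi (W w)).
  by move=> mW; apply: bounded_rv01 => //; exact: random_element_fun mW cphi.
have bfz (W : Omega -> 'cV[R]_p) : random_element W ->
    bounded_rv (fun w => f (W w) * zeta w).
  move=> mW; apply: bounded_rvM; split.
  - exact: random_element_fun mW cf.
  - by exists M.
  - exact: measurable_wrt_fun.
  - by exists L.
have meanE (W : Omega -> 'cV[R]_p) : random_element W ->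
    mean P (fun w => f (W w) * zeta w) =
    M * L * (4 * mean P (fun w => phi (W w) * z w) +
      (-2) * mean P (fun w => phi (W w) * 1) + (-2) * mean P z + 1).
  move=> mW; have b1 := bounded_rvM (bphi _ mW) bz.
  have b2 := bounded_rvM (bphi _ mW) (bounded_rv_cst Omega 1).
  have bc c (W' : Omega -> R) (b : bounded_rv W') :=
    bounded_rvM (bounded_rv_cst Omega c) b.
  rewrite -[X in _ + X](mean_cst P) -!meanZ // -!meanD -?meanZ //;
    do ?[exact: bounded_rv_cst|exact: bc|apply: bounded_rvD].
  congr (mean P _); apply/funext => w; rewrite /phi /z.
  by field; rewrite !gt_eqF.
rewrite (expectationE P (bfz _ uhat_rv)); apply/fine_cvgP; split.
  by apply: filterS X_rv => t /bfz bt; rewrite expectationE.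
apply/cvgrPdist_le => e e0.
pose c := 6 * (M * L); have c0 : 0 < c by rewrite !mulr_gt0.
have e'0 : 0 < e / c by rewrite divr_gt0.
have one01 : 0 <= (1 : R) <= 1 by rewrite ler01 lexx.
have cvz := mean_argmax_cvg aX X_rv cphi phi01 Gz' z01 e'0.
have cv1 := mean_argmax_cvg aX X_rv cphi phi01 (measurable_wrt_cst 1)
  (fun=> one01) e'0.
apply: filterS3 X_rv cvz cv1 => t mXt h1 h2.
rewrite /= (expectationE P (bfz _ mXt)) [fine _]/=.
rewrite (meanE _ mXt) (meanE _ uhat_rv).
rewrite -mulrBr normrM gtr0_norm ?mulr_gt0 //.
have -> : e = M * L * (6 * (e / c)) by rewrite /c; field; rewrite !gt_eqF.
rewrite ler_pM2l ?mulr_gt0 //.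
move: h1 h2.
move: (mean P _) (mean P _) (mean P z) (mean P _) (mean P _) (e / c).
move=> a1 a2 a3 a4 a5 a6; rewrite !ler_distlC => /andP[? ?] /andP[? ?].
by apply/andP; split; lra.
Qed.

(** The truncated distance vanishes at (uhat, uhat), so its mean at (X_t, Y_t)
    tends to 0; Markov's inequality concludes. *)
Theorem asymptotic_argmax_equiv (X Y : I -> Omega -> 'cV[R]_p) :
  asymptotic_argmax X -> asymptotic_argmax Y ->
  (\forall t \near F, random_element (X t)) ->
  (\forall t \near F, random_element (Y t)) ->
  cvg0_in_probability P F (fun t w => (enorm (X t w - Y t w))%:E).
Proof.
move=> aX aY X_rv Y_rv eps eps0.
pose dist (z : 'cV[R]_p * 'cV[R]_p) := enorm (z.1 - z.2).
have cdist : continuous dist.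
  move=> z; rewrite /dist.
  apply: (@continuous_comp ('cV[R]_p * 'cV[R]_p)%type 'cV[R]_p R
    (fun z => z.1 - z.2) (@enorm R p) z).
    exact: sub_continuous.
  exact: enorm_continuous.
pose phi z := Num.min 1 (dist z / eps).
have cphi : continuous phi.
  move=> z; apply: (@continuous_min _ _ (fun=> 1) (fun z => dist z / eps)).
    exact: cvg_cst.
  by apply: cvgM; [exact: cdist|exact: cvg_cst].
have phi01 z : 0 <= phi z <= 1.
  rewrite /phi ge_min lexx le_min ler01 /= andbT divr_ge0 ?(ltW eps0) //.
  exact: enorm_ge0.
pose A t := [set w | (eps%:E < `|(enorm (X t w - Y t w))%:E|)%E].
have mA t : random_element (X t) -> random_element (Y t) -> measurable (A t).
  move=> mX mY; have := measurable_fun_pair mX mY cdist.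
  move=> /(_ measurableT `]eps, +oo[%classic (measurable_itv _)).
  rewrite setTI; apply: measurable_ext => w.
  by rewrite /A /= in_itv /= andbT lte_fin ger0_norm // enorm_ge0.
apply/fine_cvgP; split.
  by apply: filterS2 X_rv Y_rv => t mX mY; apply: fin_num_measure; exact: mA.
apply/cvgrPdist_le => e e0.
have one01 : 0 <= (1 : R) <= 1 by rewrite ler01 lexx.
have small := limsup_mean_argmax_pair aX aY X_rv Y_rv cphi phi01
  (measurable_wrt_cst 1) (fun=> one01) e0.
apply: filterS3 X_rv Y_rv small => t mX mY.
move=> le_e; have {}le_e : mean P (fun w => phi (X t w, Y t w) * 1) <= e.
  apply: (le_trans le_e).
  rewrite [X in X + _](_ : _ = 0) ?add0r // -[RHS](mean_cst P).
  congr (mean P _); apply/funext => w.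
  by rewrite /phi /dist subrr enorm0 mul0r mulr1 minEle ler10.
apply: (le_trans _ le_e); rewrite /= -/(A t) sub0r normrN ger0_norm; last first.
  exact/fine_ge0/measure_ge0.
rewrite -(mean_indic P (mA _ mX mY)); apply: le_mean.
- by apply: bounded_rv_indic; exact: mA.
- apply: bounded_rvM; last exact: bounded_rv_cst.
  by apply: bounded_rv01 => //; exact: measurable_fun_pair.
move=> w; rewrite mulr1 indicE; have /andP[p0 _] := phi01 (X t w, Y t w).
have [Aw|nAw] := pselect (A t w); last by rewrite memNset.
rewrite mem_set //= /phi /dist /= le_min lexx /= ler_pdivlMr // mul1r ltW //.
by move: Aw; rewrite /A /= lte_fin ger0_norm // enorm_ge0.
Qed.

End stable_argmax.

(** * Measurability of the events of the quasi-likelihood analysis *)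

Lemma continuous_matrix (R : realType) (T : topologicalType) m n
    (f : T -> 'M[R]_(m, n)) :
  (forall i j, continuous (fun x => f x i j)) -> continuous f.
Proof.
move=> cf x A [Q nQ QA].
have near_ij (ij : 'I_m * 'I_n) : nbhs x [set y | Q ij.1 ij.2 (f y ij.1 ij.2)].
  exact: cf (nQ ij.1 ij.2).
apply: filterS (filter_forall _ near_ij) => y h.
by apply: QA => i j; exact: (h (i, j)).
Qed.

Lemma mulmx_continuous (R : realType) m n k (a : 'M[R]_(m, n)) :
  continuous (fun u : 'M[R]_(n, k) => a *m u).
Proof.
apply: continuous_matrix => i j.
rewrite (_ : (fun x => _) = fun u : 'M[R]_(n, k) => \sum_l a i l * u l j).
  apply: continuous_big => [|l _ u]; first exact: add_continuous.
  apply: (@continuous_comp _ _ _ (fun u : 'M[R]_(n, k) => u l j)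
    (fun z : R => a i l * z)); first exact: coord_continuous.
  exact: mulrl_continuous.
by apply/funext => u; rewrite mxE.
Qed.

Lemma affine_continuous (R : realType) m n k (b : 'M[R]_(m, k))
    (a : 'M[R]_(m, n)) : continuous (fun u : 'M[R]_(n, k) => b + a *m u).
Proof.
move=> u; apply: (@continuous_comp _ _ _ (fun u : 'M[R]_(n, k) => a *m u)
  (fun v => b + v)); first exact: mulmx_continuous.
apply: continuous_matrix => i j v.
rewrite /continuous_at; under eq_cvg do rewrite mxE; rewrite mxE.
apply: (@continuous_comp _ _ _ (fun u : 'M[R]_(m, k) => u i j)
  (fun z : R => b i j + z)); first exact: coord_continuous.
by apply: cvgD; [exact: cvg_cst|exact: cvg_id].
Qed.

Lemma within_continuous_comp (S T W : topologicalType) (A : set S) (B : set T)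
    (m : S -> T) (h : T -> W) :
  continuous m -> (forall x, A x -> B (m x)) ->
  {within B, continuous h} -> {within A, continuous (h \o m)}.
Proof.
move=> cm AB /(@subspace_continuousP _ B _ h) ch.
apply/(@subspace_continuousP _ A _ (h \o m)) => x Ax C nC.
have := ch (m x) (AB x Ax) C nC; rewrite /= => hC.
have := cm x _ hC; rewrite /within /= => hx.
apply: (@filterS _ _ (nbhs_filter x) _ _ _ hx) => y /= hy Ay.
by apply: hy; exact: AB.
Qed.

Lemma continuous_pair (S T W : topologicalType) (f : S -> T) (g : S -> W) :
  continuous f -> continuous g -> continuous (fun x => (f x, g x)).
Proof.
move=> cf cg x A [[B C] [/= nB nC] BC].
apply: (@filterS _ _ (nbhs_filter x) _ _ _
  (@filterI _ _ (nbhs_filter x) _ _ (cf x _ nB) (cg x _ nC))) => y yBC.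
exact: (BC (f y, g y)).
Qed.

Section quasi_likelihood.
Context d (Omega : measurableType d) (R : realType) (p q : nat).
Variables (Theta : set 'cV[R]_p) (Tau : set 'cV[R]_q).
Variable h : Omega -> 'cV[R]_p * 'cV[R]_q -> R.
Hypothesis h_meas : forall xi, (Theta `*` Tau) xi ->
  measurable_fun [set: Omega] (fun w => h w xi).
Hypothesis h_cont : forall w, {within Theta `*` Tau, continuous (h w)}.
Variables (theta : 'cV[R]_p) (a : 'M[R]_p).
Hypothesis theta_in : Theta theta.
Let U := local_set Theta theta a.
Let ZZ w (x : 'cV[R]_p * 'cV[R]_q) := likelihood_ratio theta a (h w) x.1 x.2.

Let sep : @separable R ('cV[R]_p * 'cV[R]_q)%type.
Proof. by apply: separable_prod; exact: separable_cV. Qed.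

Lemma measurable_likelihood_ratio x : U x.1 -> Tau x.2 ->
  measurable_fun setT (fun w => ZZ w x).
Proof.
move=> Ux Tx; apply: measurableT_comp; first exact: measurable_expR.
by apply: measurable_funB; exact: h_meas.
Qed.

Lemma likelihood_ratio_continuous (X : set ('cV[R]_p * 'cV[R]_q)) w :
  (forall x, X x -> U x.1 /\ Tau x.2) -> {within X, continuous (ZZ w)}.
Proof.
move=> XU.
have csnd : continuous (fun x : 'cV[R]_p * 'cV[R]_q => x.2).
  by move=> x; exact: cvg_snd.
have h1 : {within X, continuous (h w \o (fun x => (theta + a *m x.1, x.2)))}.
  apply: within_continuous_comp (@h_cont w); last by move=> x /XU.
  apply: continuous_pair csnd => x.
  apply: (@continuous_comp _ _ _ fst (fun u : 'cV[R]_p => theta + a *m u)).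
    exact: cvg_fst.
  exact: affine_continuous.
have h2 : {within X, continuous (h w \o (fun x => (theta, x.2)))}.
  apply: within_continuous_comp (@h_cont w); last by move=> x /XU[].
  by apply: continuous_pair csnd; exact: cst_continuous.
move/(@subspace_continuousP _ X) in h1; move/(@subspace_continuousP _ X) in h2.
apply/(@subspace_continuousP _ X _ (ZZ w)) => x Xx.
apply: continuous_cvg; first exact: continuous_expR.
by apply: cvgB; [exact: h1|exact: h2].
Qed.

Lemma measurable_sup_likelihood_ratio (r : R) :
  measurable [set w | (1 <= ereal_sup [set (ZZ w x)%:E
    | x in [set x | U x.1 /\ Tau x.2 /\ (r <= enorm x.1)%R]])%E].
Proof.
have := @emeasurable_fun_c_infty _ _ R _ _ measurableT
  (@measurable_sup _ Omega R _
    [set x | U x.1 /\ Tau x.2 /\ (r <= enorm x.1)%R] ZZ sep _ _) 1%E.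
rewrite setTI; apply.
- by move=> x [Ux [Tx _]]; exact: measurable_likelihood_ratio.
- by move=> w; apply: likelihood_ratio_continuous => x [? []].
Qed.

Lemma measurable_sup_dist (V : Omega -> Cspace 'cV[R]_p R) (K : set 'cV[R]_p)
    (e : R) : random_element V ->
  measurable [set w | (e%:E < `|ereal_sup [set `|ZZ w x - V w x.1|%:E
    | x in (U `&` K) `*` Tau]|)%E].
Proof.
move=> mV; set X := (U `&` K) `*` Tau.
have XU x : X x -> U x.1 /\ Tau x.2 by move=> [[]].
pose f w (x : 'cV[R]_p * 'cV[R]_q) := `|ZZ w x - V w x.1|.
have mf x : X x -> measurable_fun setT (f ^~ x).
  move=> /XU[Ux Tx]; apply: measurableT_comp => //.
  apply: measurable_funB; first exact: measurable_likelihood_ratio.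
  exact: (random_element_fun mV (@Ceval_continuous _ R x.1)).
have cf w : {within X, continuous (f w)}.
  have cZ := @likelihood_ratio_continuous X w XU.
  move/(@subspace_continuousP _ X) in cZ.
  apply/(@subspace_continuousP _ X _ (f w)) => x Xx.
  apply: cvg_norm; apply: cvgB; first exact: cZ.
  apply: cvg_within_filter.
  apply: (@continuous_comp _ _ _ fst (V w)); first exact: cvg_fst.
  exact: (@cts_fun _ _ (V w)).
have := @emeasurable_fun_o_infty _ _ R _ _ measurableT
  (measurableT_comp (@abse_measurable R setT)
    (@measurable_sup _ Omega R _ X f sep mf cf)) e%:E.
by rewrite setTI.
Qed.

(** With the second argument set to the random point tauhat w, h is still a
    continuous random field in its first argument. *)
Lemma measurable_argmax (tauhat : Omega -> 'cV[R]_q)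
    (thetahat : Omega -> 'cV[R]_p) :
  random_element tauhat -> (forall w, Tau (tauhat w)) ->
  random_element thetahat -> (forall w, Theta (thetahat w)) ->
  measurable [set w | (h w (thetahat w, tauhat w))%:E =
                ereal_sup [set (h w (th, tauhat w))%:E | th in Theta]].
Proof.
move=> mtau tau_in mtheta th_in.
have mpair (X : Omega -> 'cV[R]_p) : random_element X ->
    forall x e, measurable [set w | ball x e (X w, tauhat w)].
  move=> mX [x y] e.
  have := measurableI _ _ (random_element_ball x e mX)
    (random_element_ball y e mtau).
  by apply: measurable_ext => w.
have mcomp (X : Omega -> 'cV[R]_p) : random_element X ->
    (forall w, Theta (X w)) ->
    measurable_fun setT (fun w => h w (X w, tauhat w)).
  move=> mX X_in.
  apply: (@measurable_random_field_comp _ _ _ _ (Theta `*` Tau) h sep h_meas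
    (@h_cont) (fun w => (X w, tauhat w))).
    by move=> w; split; [exact: X_in|exact: tau_in].
  exact: mpair.
have mcst (x : 'cV[R]_p) : random_element (fun=> x : 'cV[R]_p).
  by move=> B _; rewrite preimage_cst; case: ifP.
rewrite -[X in measurable X]setTI; apply: measurable_eqe => //.
  by apply/measurable_EFinP; exact: mcomp.
apply: (@measurable_sup _ Omega R _ Theta (fun w th => h w (th, tauhat w))
  (@separable_cV R p)).
- by move=> x Tx; exact: (mcomp (fun=> x)).
- move=> w; apply: (@within_continuous_comp _ _ _ Theta (Theta `*` Tau)
    (fun th => (th, tauhat w)) (h w)); last exact: h_cont.
    by apply: continuous_pair; [move=> x A|exact: cst_continuous].
  by move=> x Tx; split=> //; exact: tau_in.
Qed.

End quasi_likelihood.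

(** * From maximizers of the random field to near-maximizers *)

Lemma limf_esup_lt_near (R : realType) (T : choiceType) (X : filteredType T)
    (f : X -> \bar R) (F : set_system X) (l : \bar R) {FF : Filter F} :
  (limf_esup f F < l)%E -> \forall x \near F, (f x <= l)%E.
Proof.
move=> /ereal_inf_lt[_ [A FA <-] supA].
apply: filterS FA => x Ax; apply: le_trans (ltW supA).
by apply: ereal_sup_ubound; exists x.
Qed.

Lemma cvg_fin_le (R : realType) (I : Type) (F : set_system I) (f : I -> \bar R)
    (l eta : R) {FF : Filter F} : f @ F --> l%:E -> 0 < eta ->
  \forall t \near F, (l - eta <= fine (f t) <= l + eta) /\ f t \is a fin_num.
Proof.
move=> /fine_cvgP[fin /cvgrPdist_le cv] eta0.
by apply: filterS2 fin (cv _ eta0) => t ft; rewrite ler_distlC.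
Qed.

Lemma le_probabilityU2 d (Omega : measurableType d) (R : realType)
    (P : probability Omega R) (A B : set Omega) (x y : R) :
  measurable A -> measurable B -> (P A <= x%:E)%E -> (P B <= y%:E)%E ->
  (P (A `|` B) <= (x + y)%:E)%E.
Proof.
move=> mA mB PA PB; apply: (le_trans (measureU2 _ mA mB)).
by rewrite EFinD leeD.
Qed.

(** Since z 0 tau = 1, the maximizer u of z has value at least 1, hence lies in
    the ball.  Passing from z to v costs e / 2 at each of the two points that
    are compared. *)
Lemma maximizer_near_argmax (R : realType) (p q : nat) (Ut U : set 'cV[R]_p)
    (Tau : set 'cV[R]_q) (z : 'cV[R]_p -> 'cV[R]_q -> R) (v : 'cV[R]_p -> R)
    (u : 'cV[R]_p) (tau : 'cV[R]_q) (r e : R) :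
  let K := closure (eball r) in
  0 < e -> Ut u -> Tau tau -> Ut 0 -> z 0 tau = 1 ->
  (forall x, Ut x -> z x tau <= z u tau) ->
  (forall x y, Ut x -> Tau y -> r <= enorm x -> z x y < 1) ->
  (forall x y, Ut x -> K x -> Tau y -> `|z x y - v x| <= e / 2) ->
  (forall x, K x -> U x -> exists2 y, Ut y & ball x e y) ->
  (forall x, K x -> Ut x -> exists2 y, U y & ball x e y) ->
  near_argmax U (eball r) e v u.
Proof.
move=> K e0 Utu Tt Ut0 z0 umax far close inner outer.
have Du : eball r u.
  rewrite /eball /= ltNge; apply/negP => ru.
  by have := far _ _ Utu Tt ru; rewrite ltNge -z0 umax.
have DK : eball r `<=` K by exact: subset_closure.
split => //; first by have [y Uy uy] := outer _ (DK _ Du) Utu; exists y.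
move=> x Ux xD.
have [y Uty xy] := inner _ (DK _ (xD _ (ballxx x e0))) Ux; exists y => //.
have := close _ _ Uty (DK _ (xD _ xy)) Tt; have := close _ _ Utu (DK _ Du) Tt.
by have := umax _ Uty; rewrite !ler_distlC => ? /andP[? ?] /andP[? ?]; lra.
Qed.

(** * Asymptotic distribution of the quasi-maximum likelihood estimator *)

(** It remains to check that the rescaled estimator and the exact maximizers of
    A5 are asymptotic near-maximizers of V_t. *)
Theorem theorem2p1 (R : realType) (d : measure_display) (Omega : measurableType d)
  (P : probability Omega R) (G : set (set Omega))
  (G_sigma : sigma_algebra [set: Omega] G)
  (G_sub : G `<=` [set A | measurable A])
  (p q : nat) (Theta : set 'cV[R]_p) (Tau : set 'cV[R]_q)
  (Theta_meas : borel 'cV[R]_p Theta) (Tau_meas : borel 'cV[R]_q Tau)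
  (TT : set R) (TT_sup : ereal_sup [set t%:E | t in TT] = +oo%E)
  (H : R -> Omega -> 'cV[R]_p * 'cV[R]_q -> R)
  (H_meas : forall t, TT t -> forall xi, (Theta `*` Tau) xi ->
     measurable_fun [set: Omega] (fun w => H t w xi))
  (H_cont : forall t, TT t -> forall w, {within Theta `*` Tau, continuous (H t w)})
  (theta : 'cV[R]_p) (theta_in : Theta theta)
  (tauhat : R -> Omega -> 'cV[R]_q)
  (tauhat_rv : forall t, TT t -> random_element (tauhat t))
  (tauhat_in : forall t, TT t -> forall w, Tau (tauhat t w))
  (thetahat : R -> Omega -> 'cV[R]_p)
  (thetahat_rv : forall t, TT t -> random_element (thetahat t))
  (thetahat_in : forall t, TT t -> forall w, Theta (thetahat t w))
  (thetahat_max :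
     P [set w | (H t w (thetahat t w, tauhat t w))%:E =
                ereal_sup [set (H t w (th, tauhat t w))%:E | th in Theta]]
       @[t --> at_infty TT] --> 1%E)
  (a : R -> 'M[R]_p) (a_unit : forall t, TT t -> a t \in unitmx)
  (a_to0 : frobnorm (a t) @[t --> at_infty TT] --> (0 : R))
  (V : R -> Omega -> Cspace 'cV[R]_p R)
  (V_rv : forall t, TT t -> random_element (V t))
  (Z : Omega -> Cspace 'cV[R]_p R) (Z_rv : random_element Z) :
  let U_ := fun t => local_set Theta theta (a t) in
  let U := limit_set TT U_ in
  let ZZ := fun t w u tau => likelihood_ratio theta (a t) (H t w) u tau in
  let uhat_ := fun t w => invmx (a t) *m (thetahat t w - theta) in
  forall
  (A1 : limf_esup (fun r : R =>
          limf_esup (fun t =>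
            P [set w | (1 <= ereal_sup
                 [set (ZZ t w x.1 x.2)%:E
                 | x in [set x | U_ t x.1 /\ Tau x.2 /\ (r <= enorm x.1)%R]])%E])
          (at_infty TT)) (pinfty_nbhs R) = 0%E)
  (A2 : forall r : R, 0 < r ->
     cvg0_in_probability P (at_infty TT)
       (fun t w => ereal_sup
          [set `|ZZ t w x.1 x.2 - V t w x.1|%:E
          | x in (U_ t `&` closure (eball r)) `*` Tau]) /\
     stable_cvg P G (at_infty TT)
       (fun t w => Crestrict (closure (eball r)) (V t w))
       (fun w => Crestrict (closure (eball r)) (Z w)))
  (A3 : \bigcap_(N in [set N : nat | (0 < N)%N])
          closure (\bigcup_(t in tail TT N%:R) U_ t) `<=` U)
  (uhat : Omega -> 'cV[R]_p)
  (A4 : [/\ random_element uhat, (forall w, U (uhat w)),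
     {ae P, forall w,
        (Z w (uhat w))%:E = ereal_sup [set (Z w u)%:E | u in U]} &
     {ae P, forall w, forall u, U u -> u <> uhat w -> Z w u < Z w (uhat w)}]),
  stable_cvg P G (at_infty TT) uhat_ uhat /\
  forall (T0 : R) (vhat : R -> Omega -> 'cV[R]_p)
  (A5 : [/\ TT T0,
     (forall t, tail TT T0 t ->
        random_element (vhat t) /\ (forall w, U (vhat t w))),
     (forall t, tail TT T0 t ->
        {ae P, forall w,
           (V t w (vhat t w))%:E = ereal_sup [set (V t w u)%:E | u in U]}) &
     tight_on P (tail TT T0) vhat]),
  cvg0_in_probability P (at_infty TT)
    (fun t w => (enorm (uhat_ t w - vhat t w))%:E).
Proof.
move=> U_ U ZZ uhat_ A1 A2 A3 uhat [uhat_rv uhat_in _ uhat_uniq].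
have FF : ProperFilter (at_infty TT) by exact: at_infty_proper.
have near_TT : \forall t \near at_infty TT, TT t.
  by apply/at_inftyP; exists 0.
have U_closed : closed U by exact: limit_set_closed.
have V_near : \forall t \near at_infty TT, random_element (V t).
  by apply: filterS near_TT => t; exact: V_rv.
have VZ r (r0 : 0 < r) := (A2 r r0).2.
have uhat__rv : \forall t \near at_infty TT, random_element (uhat_ t).
  apply: filterS near_TT => t Tt.
  have cf : continuous (fun x : 'cV[R]_p => invmx (a t) *m (x - theta)).
    move=> x; apply: (@continuous_comp _ _ _ (fun x : 'cV[R]_p => x - theta)
      (fun y => invmx (a t) *m y)); last exact: mulmx_continuous.
    rewrite (_ : (fun x : 'cV[R]_p => x - theta) =
        fun x => - theta + 1%:M *m x); first exact: affine_continuous.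
    by apply/funext => y; rewrite mul1mx addrC.
  exact: (random_element_comp (thetahat_rv t Tt) cf).
have aM t x : TT t -> theta + a t *m (invmx (a t) *m (x - theta)) = x.
  by move=> Tt; rewrite mulKVmx ?a_unit // addrC subrK.
have uhat_argmax : asymptotic_argmax P (at_infty TT) U V uhat_.
  move=> eta eta0; pose eta3 := eta / 3.
  have eta30 : 0 < eta3 by rewrite divr_gt0.
  (* Half of eta3: the inner upper limit must be strictly below eta3. *)
  have half_gt0 : 0 < eta3 / 2 by rewrite divr_gt0.
  have [M [_ hM]] : \forall r \near +oo, (limf_esup (fun t =>
      P [set w | (1 <= ereal_sup [set (ZZ t w x.1 x.2)%:E
        | x in [set x | U_ t x.1 /\ Tau x.2 /\ (r <= enorm x.1)%R]])%E])
      (at_infty TT) <= (eta3 / 2)%:E)%E.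
    by apply: limf_esup_lt_near; rewrite A1 lte_fin.
  (* The neighbourhoods of +oo are open half-lines and A2 is about r > 0. *)
  exists (Num.max (M + 1) 1) => r; rewrite ge_max => /andP[Mr r1] e e0.
  have r0 : 0 < r by exact: lt_le_trans r1.
  have e20 : 0 < e / 2 by rewrite divr_gt0.
  have limA1 : \forall t \near at_infty TT, (P [set w | (1 <= ereal_sup
      [set (ZZ t w x.1 x.2)%:E
      | x in [set x | U_ t x.1 /\ Tau x.2 /\ (r <= enorm x.1)%R]])%E]
      <= eta3%:E)%E.
    apply: limf_esup_lt_near; apply: (le_lt_trans (hM r _)); first by lra.
    by rewrite lte_fin; lra.
  have lim_max := cvg_fin_le thetahat_max eta30.
  have lim_A2 := cvg_fin_le ((A2 r r0).1 _ e20) eta30.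
  have cK : compact (closure (@eball R p r)) by exact: compact_closure_eball.
  have inner := limit_set_inner TT U_ cK e0.
  have outer := limit_set_outer A3 cK e0.
  near=> t.
  have Tt : TT t by near: t.
  have in_t : forall x, closure (eball r) x -> U x ->
      exists2 y, U_ t y & ball x e y by near: t; exact: inner.
  have out_t : forall x, closure (eball r) x -> U_ t x ->
      exists2 y, U y & ball x e y by near: t; exact: outer.
  pose B1 := [set w | (1 <= ereal_sup [set (ZZ t w x.1 x.2)%:E
      | x in [set x | U_ t x.1 /\ Tau x.2 /\ (r <= enorm x.1)%R]])%E].
  have PB1 : (P B1 <= eta3%:E)%E by rewrite /B1; near: t.
  have mB1 : measurable B1.
    exact: (measurable_sup_likelihood_ratio (H_meas t Tt) (H_cont t Tt) (a t)
      theta_in r).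
  pose E := [set w | (H t w (thetahat t w, tauhat t w))%:E =
      ereal_sup [set (H t w (th, tauhat t w))%:E | th in Theta]].
  have mE : measurable E.
    exact: (measurable_argmax (H_meas t Tt) (H_cont t Tt) (tauhat_rv t Tt)
      (tauhat_in t Tt) (thetahat_rv t Tt) (thetahat_in t Tt)).
  have PE : (P (~` E) <= eta3%:E)%E.
    rewrite probability_setC //.
    have [] : 1 - eta3 <= fine (P E) <= 1 + eta3 /\ P E \is a fin_num.
      by rewrite /E; near: t; exact: lim_max.
    move=> /andP[h _] fE; rewrite -(fineK fE) -EFinB lee_fin; lra.
  pose B2 := [set w | ((e / 2)%:E < `|ereal_sup
      [set `|ZZ t w x.1 x.2 - V t w x.1|%:E
          | x in (U_ t `&` closure (eball r)) `*` Tau]|)%E].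
  have mB2 : measurable B2.
    exact: (measurable_sup_dist (H_meas t Tt) (H_cont t Tt) (a t) theta_in _ _
      (V_rv t Tt)).
  have PB2 : (P B2 <= eta3%:E)%E.
    have [] : 0 - eta3 <= fine (P B2) <= 0 + eta3 /\ P B2 \is a fin_num.
      by rewrite /B2; near: t; exact: lim_A2.
    by move=> /andP[_ h] fB; rewrite -(fineK fB) lee_fin -[leRHS]add0r.
  exists (B1 `|` ~` E `|` B2).
    split; first by do ?[apply: measurableU|apply: measurableC].
    have -> : eta = eta3 + eta3 + eta3 by rewrite /eta3; lra.
    apply: le_probabilityU2 => //; first exact: measurableU _ (measurableC _).
    by apply: le_probabilityU2 => //; exact: measurableC.
  move=> w /not_orP[/not_orP[nB1 /contrapT Ew] nB2].
  have Ut0 : U_ t 0 by rewrite /U_ /local_set /= mulmx0 addr0.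
  apply: (@maximizer_near_argmax R p q (U_ t) U Tau (ZZ t w) (V t w)
    (uhat_ t w) (tauhat t w)) => //.
  - by rewrite /U_ /local_set /= aM //; exact: thetahat_in.
  - exact: tauhat_in.
  - by rewrite /ZZ /likelihood_ratio mulmx0 addr0 subrr expR0.
  - move=> x Ux; rewrite /ZZ /likelihood_ratio ler_expR lerD2r aM //.
    by rewrite -lee_fin Ew; apply: ereal_sup_ubound; exists (theta + a t *m x).
  - move=> x y Ux Ty rx; rewrite ltNge; apply/negP => z1; apply: nB1.
    rewrite /B1 /=; apply: (@le_trans _ _ (ZZ t w x y)%:E).
      by rewrite lee_fin.
    by apply: ereal_sup_ubound; exists (x, y).
  - move=> x y Ux Kx Ty; rewrite leNgt; apply/negP => ze; apply: nB2.
    rewrite /B2 /=; apply: (@lt_le_trans _ _ (`|ZZ t w x y - V t w x|)%:E).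
      by rewrite lte_fin.
    apply: le_trans (lee_abs _).
    by apply: ereal_sup_ubound; exists (x, y).
split; first exact: (asymptotic_argmax_stable_cvg G_sigma G_sub V_near Z_rv VZ
  U_closed uhat_rv uhat_in uhat_uniq uhat_argmax uhat__rv).
move=> T0 vhat [TT0 vhat_rv vhat_max vhat_tight].
have near_T0 : \forall t \near at_infty TT, tail TT T0 t.
  by apply/at_inftyP; exists T0 => t /ltW.
have vhat__rv : \forall t \near at_infty TT, random_element (vhat t).
  by apply: filterS near_T0 => t /vhat_rv[].
have vhat_argmax : asymptotic_argmax P (at_infty TT) U V vhat.
  move=> eta eta0; have [K cK PK] := vhat_tight _ eta0.
  have [r0 r0K] := compact_sub_eball cK.
  exists r0 => r r0r e e0; apply: filterS near_T0 => t Tt.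
  have [mvt vt_in] := vhat_rv t Tt.
  have [N [mN PN NP]] := vhat_max t Tt.
  have mK : measurable (vhat t @^-1` ~` K).
    apply: mvt; apply: sub_sigma_algebra => /=; apply: closed_openC.
    by apply: compact_closed => //; exact: norm_hausdorff.
  exists (vhat t @^-1` (~` K) `|` N).
    split; first exact: measurableU.
    rewrite -[eta]addr0; apply: le_probabilityU2 => //; first exact: PK.
    by rewrite PN.
  move=> w /not_orP[/contrapT Kw nNw].
  have maxw : (V t w (vhat t w))%:E = ereal_sup [set (V t w u)%:E | u in U].
    by apply: contrapT => nmax; apply: nNw; exact: NP.
  split; first exact: r0K Kw.
    by exists (vhat t w) => //; exact: ballxx.
  move=> u Uu _; exists u; first exact: ballxx.
  have : (V t w u <= V t w (vhat t w)).
    by rewrite -lee_fin maxw; apply: ereal_sup_ubound; exists u.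
  by move=> /le_trans; apply; rewrite lerDl ltW.
exact: (asymptotic_argmax_equiv G_sigma G_sub V_near Z_rv VZ
  U_closed uhat_rv uhat_in uhat_uniq uhat_argmax vhat_argmax uhat__rv vhat__rv).
Unshelve. all: by end_near. Qed.
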